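(* Let $m,a,l$ be integers with $m\ge 1$ and $a\ge 0$. Then for all integers $n\ge 1$, $$\mathcal{D}_{1,l-1,1}^{(m-1,a)}(n) = \mathcal{L}_{1,l-1,1}^{(m-1,a)}(n) = \tfrac{1}{2}\, \det_{0\le i,j\le n-1} \left(l^{j}\binom{mi+j+a}{mi+a} + \binom{mi-j+a}{mi+a}\right).$$
   Context: Conventions: $\mathbb{N}=\{0,1,2,\ldots\}$; $0^0=1$; for an integer $p$, $\binom{\alpha}{p}=\frac{\alpha(\alpha-1)\cdots(\alpha-p+1)}{p!}$ if $p\ge 0$ and $\binom{\alpha}{p}=0$ if $p<0$ (so $\alpha$ may be negative). A partition of length $n$ is a sequence $\lambda=(\lambda_1,\ldots,\lambda_n)$ of integers with $\lambda_1\ge\cdots\ge\lambda_n\ge 0$. For $s,r\in\mathbb{N}$ put $\lambda^{(s,r)}=(s(n-1)+r,\,s(n-2)+r,\ldots,r)$, a partition of length $n$. Lattice paths. A Delannoy path is a lattice path in $\mathbb{Z}^2$ with steps east $(1,0)$, north $(0,1)$, northeast $(1,1)$. For a partition $\lambda$ of length $n$, a system of nonintersecting Delannoy paths marked by $\lambda$ is an $n$-tuple $p=(p_1,\ldots,p_n)$ where $p_j$ is a Delannoy path from $(-j,j)$ to $(\lambda_j-j,n)$ and no two different paths share a lattice point. For $w_1,w_2,w_3\in\mathbb{C}$, the weight of $p$ is $w_1^{e}w_2^{f}w_3^{g}$, where $e,f,g$ are the total numbers of east, north, northeast steps in all of $p_1,\ldots,p_n$. $\mathcal{L}_{w_1,w_2,w_3}^{(s,r)}(n)$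 is the sum of the weights of all systems of nonintersecting Delannoy paths marked by $\lambda^{(s,r)}$. Domino tilings. Label each unit square of the Cartesian grid by its left-top point. For $M,N\in\mathbb{N}$, the prototypical domain $A(M;N)$ is the union, over $0\le k\le N$, of the $k$-th diagonals, the $k$-th diagonal consisting of the $M+\lceil k/2\rceil$ unit squares labeled $(i,i-k)$ with $0\le i\le M+\lceil k/2\rceil-1$. Squares in even-indexed diagonals are white; squares in odd-indexed diagonals are gray. The boundary encoding of a partition $\lambda$ of length $n$ is the word of circles and bullets read along the southeast boundary of its Young diagram (with $n$ rows, zero rows allowed) from southwest to northeast, with a circle for each east edge and a bullet for each north edge; i.e. $\circ^{\lambda_n}\bullet\,\circ^{\lambda_{n-1}-\lambda_n}\bullet\cdots\circ^{\lambda_1-\lambda_2}\bullet$, a word of length $\lambda_1+n$. The Aztec-type domain of Type 1 marked by $\lambda$ is obtained from $A(\lambda_1;2n-1)$ by writing the boundary encoding of $\lambda$ into the $\lambda_1+n$ squares of its last diagonal from left-bottom to right-top (increasing $i$) and removing the squares that receive a bullet. A domino covers two edge-adjacent unit squares; there are four types: $\mathfrak{D}_1$ vertical with gray bottom square and white top square; $\mathfrak{D}_2$ vertical with white bottom and gray top; $\mathfrak{D}_3$ horizontal with gray left and white right; $\mathfrak{D}_4$ horizontal with white left and gray right. The weight of a domino tiling $T$ is $w_1^{\#\mathfrak{D}_1}w_2^{\#\mathfrak{D}_2}w_3^{\#\mathfrak{D}_3}$, where $\#\mathfrak{D}_i$ is the number of dominoes of type $\mathfrak{D}_i$ in $T$.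 $\mathcal{D}_{w_1,w_2,w_3}^{(s,r)}(n)$ is the sum of the weights of all domino tilings of the Type 1 domain marked by $\lambda^{(s,r)}$. *)

(* Defs.v *)
From HB Require Import structures.
From mathcomp Require Import all_boot all_order all_algebra.
From mathcomp Require Import finmap.

Set Implicit Arguments.
Unset Strict Implicit.
Unset Printing Implicit Defensive.

Import Order.TTheory GRing.Theory Num.Theory.
Local Open Scope ring_scope.

Definition gbin (alpha : rat) (p : int) : rat :=
  match p with
  | Posz k => (\prod_(i < k) (alpha - i%:R)) / (k`!)%:R
  | Negz _ => 0
  end.

(* The entry at position i (counted from 0) is lambda_(i+1) = s (n - 1 - i) + r. *)
Definition lambda_sr (s r n : nat) : n.-tuple nat :=
  [tuple (s * (n - 1 - i) + r)%N | i < n].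

(* Points of Z^2, also used as labels (left-top corners) of unit squares; the
   second coordinate grows northwards. *)
Definition point := (int * int)%type.

Inductive step := East | North | Northeast.

Definition step_code (s : step) : 'I_3 :=
  match s with
  | East => inord 0 | North => inord 1 | Northeast => inord 2
  end.

Definition step_decode (i : 'I_3) : step :=
  match val i with 0%N => East | 1%N => North | _ => Northeast end.

Lemma step_codeK : cancel step_code step_decode.
Proof. by case; rewrite /step_decode /step_code /= inordK. Qed.

HB.instance Definition _ := Countable.copy step (can_type step_codeK).
HB.instance Definition _ : isFinite step := CanIsFinite step_codeK.

Definition move (p : point) (s : step) : point :=
  match s with
  | East => (p.1 + 1, p.2)
  | North => (p.1, p.2 + 1)
  | Northeast => (p.1 + 1, p.2 + 1)
  end.

Definition vertices (p : point) (w : seq step) : seq point :=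
  p :: scanl move p w.

Section Paths.
Variables (n : nat) (lam : n.-tuple nat).

(* The index i : 'I_n stands for j = i + 1 in the following definitions. *)
Definition path_start (i : 'I_n) : point := (- (i.+1)%:Z, (i.+1)%:Z).

Definition path_end (i : 'I_n) : point :=
  ((tnth lam i)%:Z - (i.+1)%:Z, n%:Z).

(* The words of steps are bounded in length only to make the type finite: a
   Delannoy path from (-j, j) to (lambda_j - j, n) has at most
   lambda_j + n - j <= lambda_1 + n steps. *)
Definition path_tuple := {ffun 'I_n -> (head 0%N lam + n).-bseq step}.

Definition nonintersecting_system (p : path_tuple) : bool :=
  [forall i, foldl move (path_start i) (p i) == path_end i] &&
  [forall i, forall j, (i != j) ==>
    ~~ has (mem (vertices (path_start j) (p j)))
           (vertices (path_start i) (p i))].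

Definition total_steps (s : step) (p : path_tuple) : nat :=
  (\sum_(i < n) count_mem s (p i))%N.

Definition delannoy_sum (R : comNzRingType) (w1 w2 w3 : R) : R :=
  \sum_(p : path_tuple | nonintersecting_system p)
    w1 ^+ total_steps East p * w2 ^+ total_steps North p
      * w3 ^+ total_steps Northeast p.

End Paths.

Definition prototypical_domain (M N : nat) : {fset point} :=
  [fset c in [seq (i%:Z, i%:Z - k%:Z) | k <- iota 0 N.+1,
                                        i <- iota 0 (M + uphalf k)]]%fset.

(* Circles are encoded by false and bullets by true. *)
Definition boundary_encoding (lam : seq nat) : seq bool :=
  flatten (pairmap (fun x y => rcons (nseq (y - x) false) true) 0%N (rev lam)).

Definition type1_domain (n : nat) (lam : n.-tuple nat) : {fset point} :=
  let M := head 0%N lam in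
  let k := (2 * n - 1)%N in
  (prototypical_domain M k `\`
   [fset c in [seq (i%:Z, i%:Z - k%:Z) | i <- iota 0 (M + n)
                 & nth false (boundary_encoding lam) i]])%fset.

(* The square (x, y) lies on the diagonal with index x - y. *)
Definition gray (c : point) : bool := ~~ (2 %| c.1 - c.2)%Z.

Definition white (c : point) : bool := ~~ gray c.

(* The left or bottom square of the domino, and whether it is vertical. *)
Definition domino := (point * bool)%type.

Definition vertical (d : domino) : bool := d.2.

Definition first_square (d : domino) : point := d.1.

Definition second_square (d : domino) : point :=
  if vertical d then (d.1.1, d.1.2 + 1) else (d.1.1 + 1, d.1.2).

Definition covers (d : domino) (c : point) : bool :=
  (c == first_square d) || (c == second_square d).

Definition domino1 (d : domino) : bool :=
  [&& vertical d, gray (first_square d) & white (second_square d)].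

Definition domino2 (d : domino) : bool :=
  [&& vertical d, white (first_square d) & gray (second_square d)].

Definition domino3 (d : domino) : bool :=
  [&& ~~ vertical d, gray (first_square d) & white (second_square d)].

Definition is_tiling (D : {fset point}) (T : {fset domino}) : bool :=
  all (fun d => (first_square d \in D) && (second_square d \in D)) T &&
  all (fun c => #|` [fset d in T | covers d c]%fset| == 1%N) D.

(* Every domino of a tiling of D has its first square in D, so the tilings of D
   are among the subsets of the finite set D * bool. *)
Definition domino_sum (R : comNzRingType) (w1 w2 w3 : R) (D : {fset point}) : R :=
  \sum_(T <- fpowerset (D `*` [fset false; true])%fset | is_tiling D T)
    w1 ^+ #|` [fset d in T | domino1 d]%fset|
    * w2 ^+ #|` [fset d in T | domino2 d]%fset|
    * w3 ^+ #|` [fset d in T | domino3 d]%fset|.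

Definition delannoy_L (R : comNzRingType) (w1 w2 w3 : R) (s r n : nat) : R :=
  delannoy_sum (lambda_sr s r n) w1 w2 w3.

Definition domino_D (R : comNzRingType) (w1 w2 w3 : R) (s r n : nat) : R :=
  domino_sum w1 w2 w3 (type1_domain (lambda_sr s r n)).

(* Main.v *)
Require Import Defs.
From HB Require Import structures.
From mathcomp Require Import all_boot all_order all_algebra.
From mathcomp Require Import zify ring lra finmap.

Set Implicit Arguments.
Unset Strict Implicit.
Unset Printing Implicit Defensive.

Import Order.TTheory GRing.Theory Num.Theory.
Local Open Scope ring_scope.

(** Both sums and the determinant depend on the partition only through the
    increasing list [b] of the numbers [lambda_j + n - j], which are the places
    of the bullets in the boundary encoding; for the partition of the theorem,
    [b_i = m i + a]. With [w = l - 1], all three are values of one function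
    [Z_n (b)], given by a recursion on [n] (called [transfer] below):

      [Z_n (b) = \sum_c \sum_d w ^ #{t | d_t = c_t} Z_(n - 1) (d)],

    where [c] ranges over the lists [c_1 < ... < c_(n - 1)] interlacing with
    [b], i.e., [b_(t - 1) <= c_t < b_t], and [d] over the lists of distinct natural
    numbers with [d_t = c_t] or [d_t = c_t - 1].

    Paths. Cut a system of nonintersecting paths below its top level. The path
    that starts there goes straight to its end. Every other path enters the top
    level by a north step (weight [w]) or a northeast step (weight 1) and then
    goes east; [c] records where, and [d] records where it leaves the level
    below. Disjointness on the top level says that [c] interlaces with [b], and
    what remains is a system for [d] ([mem_systems], [sum_systems]).

    Tilings. The squares left on the last, gray, diagonal can only be matched
    with squares of the white diagonal next to it. The white squares that stay
    unmatched interlace with the removed gray squares, each choice of them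
    arising once ([gray_layer]). They in turn are matched with the next gray
    diagonal, in two possible directions ([white_layer]), and the squares used
    there are the bullets of a smaller domain ([tiling_sum_transfer]).

    Determinant. Let [E (b, h)] be the weighted number of Delannoy paths that
    climb [h] levels and end at [b]. In the determinant of the [E (b_i, h)],
    with [h < n], the column [h = 0] consists of ones, so subtracting from each
    row the previous one leaves a determinant of size [n - 1]. By the recursion
    for [E], its rows are sums over [b_(t - 1) <= c < b_t] of
    [w E (c, h) + E (c - 1, h)]. Multilinear expansion is the recursion for [Z];
    the choices with coinciding [d_t] disappear by themselves because they give
    equal rows ([transfer_rows_det]). This replaces the usual involution on
    intersecting path systems.

    Binomials. As functions of [N], the entries [E (N, h)] are the coefficients
    of [y ^ h / (1 - x)], where [y = x (w + x) / (1 - x)], while the entries of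
    column [j] of the determinant in the theorem are those of
    [(u ^ j + v ^ j) / (1 - x)], where [u = l / (1 - x)] and [v = 1 - x]. Since
    [u v = l] and [u + v = y + l + 1], the symmetric expression [u ^ j + v ^ j]
    is a polynomial in [y] of degree [j], monic for [j > 0] and equal to 2 for
    [j = 0]. The two matrices thus differ by a triangular matrix of determinant
    2 ([det_binomial_columns]), which is the factor 1/2 of the theorem. *)

(** * The common recursion and the determinant of Delannoy numbers *)

Section Transfer.
Variables (R : comNzRingType) (w : R).

(** The double sum over [c] and [d] in the recursion, carried out from left to
    right; [K] is the function of [d] being summed. *)
Fixpoint layer_sum (b0 : nat) (bs : seq nat) (K : seq nat -> R) : R :=
  if bs is b1 :: bs' then
    \sum_(b0 <= c < b1)
      (w * layer_sum b1 bs' (fun ds => K (c :: ds)) +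
       (if (0 < c)%N then layer_sum b1 bs' (fun ds => K (c.-1 :: ds)) else 0))
  else K [::].

(** A list with a repeated entry gets the value 0. This is what keeps two
    entries of [layer_sum] from descending to the same place. *)
Fixpoint transfer (n : nat) (b : seq nat) : R :=
  if n is n'.+1 then
    if b is b0 :: bs then
      if sorted ltn b then layer_sum b0 bs (transfer n') else 0
    else 0
  else 1.

(** What all the lists [ds] produced by [layer_sum b0 bs] have in common. The
    first entry may be [b0 - 1], hence the successor. *)
Fixpoint layer_image (b0 : nat) (bs ds : seq nat) : bool :=
  match bs, ds with
  | [::], [::] => true
  | b1 :: bs', d :: ds' => [&& (b0 <= d.+1)%N, (d < b1)%N & layer_image b1 bs' ds']
  | _, _ => false
  end.

Lemma eq_layer_sum b0 bs K K' :
  (forall ds, layer_image b0 bs ds -> K ds = K' ds) ->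
  layer_sum b0 bs K = layer_sum b0 bs K'.
Proof.
elim: bs b0 K K' => [|b1 bs IH] b0 K K' eK /=; first exact: eK.
apply: eq_big_nat => c /andP[le_b0c lt_cb1]; congr (_ * _ + _).
  by apply: IH => ds ids; apply: eK; rewrite /= ids; lia.
case: ifP => // c_gt0; apply: IH => ds ids; apply: eK; rewrite /= ids; lia.
Qed.

Lemma layer_image_size b0 bs ds : layer_image b0 bs ds -> size ds = size bs.
Proof.
by elim: bs b0 ds => [|b1 bs IH] b0 [|d ds] //= /and3P[_ _ /IH->].
Qed.

Lemma layer_image_path b0 bs d ds :
  layer_image b0 bs ds -> (d < b0)%N -> path leq d ds.
Proof.
elim: bs b0 d ds => [|b1 bs IH] b0 d [|d' ds] //= /and3P[le1 le2 ids] lt_d.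
by rewrite (IH b1) // andbT; lia.
Qed.

Lemma layer_image_sorted b0 bs ds : layer_image b0 bs ds -> sorted leq ds.
Proof.
case: bs ds => [|b1 bs] [|d ds] //= /and3P[_ lt_d ids].
exact: layer_image_path ids lt_d.
Qed.

(** The rows are functions on [nat] so that a list of rows can be cut to any
    size; lists rather than matrices let the rows be replaced one after the
    other. *)
Definition rows_det n (rows : seq (nat -> R)) : R :=
  \det (\matrix_(i < n, j < n) nth (fun=> 0) rows i j).

Lemma rows_det_linear n pre post (a b : R) (f g : nat -> R) :
  (size pre < n)%N ->
  rows_det n (pre ++ (fun j => a * f j + b * g j) :: post) =
  a * rows_det n (pre ++ f :: post) + b * rows_det n (pre ++ g :: post).
Proof.
move=> lt_n; apply: (determinant_multilinear (i0 := Ordinal lt_n)).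
- by apply/rowP => j; rewrite !mxE /= !nth_cat ltnn subnn.
- apply/matrixP => i j; rewrite !mxE /= !nth_cat.
  case: ltnP => // le_pre; case E: (_ - _)%N => [|k] //=.
  by case/eqP: (neq_bump (size pre) i); apply/eqP;
    rewrite eqn_leq le_pre -subn_eq0 E.
- apply/matrixP => i j; rewrite !mxE /= !nth_cat.
  case: ltnP => // le_pre; case E: (_ - _)%N => [|k] //=.
  by case/eqP: (neq_bump (size pre) i); apply/eqP;
    rewrite eqn_leq le_pre -subn_eq0 E.
Qed.

Lemma eq_rows_det n rows rows' :
  (forall i j, (i < n)%N -> nth (fun=> 0) rows i j = nth (fun=> 0) rows' i j) ->
  rows_det n rows = rows_det n rows'.
Proof.
by move=> eqr; congr (\det _); apply/matrixP => i j; rewrite !mxE eqr.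
Qed.

Lemma rows_det_row n pre post (f g : nat -> R) : f =1 g ->
  rows_det n (pre ++ f :: post) = rows_det n (pre ++ g :: post).
Proof.
move=> eq_fg; apply: eq_rows_det => i j _; rewrite !nth_cat.
by case: ltnP => // _; case: (_ - _)%N => [|k] /=.
Qed.

Lemma rows_det_sum n pre post (I : Type) (r : seq I) (f : I -> nat -> R) :
  (size pre < n)%N ->
  rows_det n (pre ++ (fun j => \sum_(c <- r) f c j) :: post) =
  \sum_(c <- r) rows_det n (pre ++ f c :: post).
Proof.
move=> lt_n; elim: r => [|c r IH].
  rewrite big_nil (rows_det_row n pre post (g := fun j => 0 * 0 + 0 * 0)).
    by rewrite rows_det_linear // !mul0r addr0.
  by move=> j; rewrite big_nil !mul0r addr0.
rewrite big_cons -IH -[X in X + _]mul1r -[X in _ + X]mul1r -rows_det_linear //.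
by apply: rows_det_row => j; rewrite big_cons !mul1r.
Qed.

(** The weighted number of paths with [h] climbs that end at position [b]:
    such a path arrives on its last level at some position [c + 1 <= b], by a
    north step from position [c] or a northeast step from position [c - 1],
    positions being sums of coordinates. *)
Fixpoint delannoy (h b : nat) : R :=
  if h is h'.+1 then
    \sum_(0 <= c < b)
      (w * delannoy h' c + (if (0 < c)%N then delannoy h' c.-1 else 0))
  else 1.

Definition hop_row (c j : nat) : R :=
  w * delannoy j c + (if (0 < c)%N then delannoy j c.-1 else 0).

(** Multilinearity in the rows, used on one row after the other: [pre] holds
    the rows that have been expanded. *)
Lemma layer_sum_rows_det n pre b0 bs :
  (size pre + size bs = n)%N ->
  layer_sum b0 bs
    (fun ds => rows_det n (pre ++ [seq delannoy^~ d | d <- ds])) =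
  rows_det n
    (pre ++ pairmap (fun x y j => \sum_(x <= c < y) hop_row c j) b0 bs).
Proof.
elim: bs b0 pre => [|b1 bs IH] b0 pre size_n //=.
have lt_n : (size pre < n)%N by rewrite -size_n /= addnS ltnS leq_addr.
rewrite rows_det_sum //; apply: eq_big_nat => c _.
have IHc (f : nat -> R) :
    layer_sum b1 bs
      (fun ds => rows_det n (pre ++ f :: [seq delannoy^~ d | d <- ds])) =
    rows_det n
      (pre ++ f ::
         pairmap (fun x y j => \sum_(x <= c < y) hop_row c j) b1 bs).
  rewrite -cat_rcons -IH ?size_rcons ?addSnnS //.
  by apply: eq_layer_sum => ds _; rewrite -cat_rcons.
rewrite !IHc; case: ifP => c_gt0.
  rewrite -[X in _ + X]mul1r -rows_det_linear //.
  by apply: rows_det_row => j; rewrite /hop_row c_gt0 mul1r.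
rewrite -[X in _ + X](mul0r (rows_det n (pre ++ (fun=> 0) ::
  pairmap (fun x y j => \sum_(x <= c < y) hop_row c j) b1 bs))).
rewrite -rows_det_linear //.
by apply: rows_det_row => j; rewrite /hop_row c_gt0 mul0r.
Qed.

Lemma rows_det_eq_rows n rows i :
  (i.+1 < n)%N -> nth (fun=> 0) rows i =1 nth (fun=> 0) rows i.+1 ->
  rows_det n rows = 0.
Proof.
move=> lt_n eq_rows.
apply: (@determinant_alternate _ _ _ (Ordinal (ltnW lt_n)) (Ordinal lt_n)).
  by rewrite -val_eqE /= neq_ltn ltnSn.
by move=> j; rewrite !mxE /= eq_rows.
Qed.

Lemma det_row_differences n (A : 'M[R]_n.+1) :
  \det A = \det (\matrix_(i < n.+1, j < n.+1)
    (A i j - if val i is i'.+1 then A (inord i') j else 0)).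
Proof.
(* Multiplication by L on the left subtracts from each row the previous one. *)
pose L : 'M[R]_n.+1 :=
  \matrix_(i, k) ((k == i)%:R - ((k.+1 == i)%N)%:R).
have detL : \det L = 1.
  rewrite det_trig.
    apply: big1 => i _; rewrite mxE eqxx.
    by rewrite (_ : (i.+1 == i)%N = false) ?subr0 //; lia.
  apply/is_trig_mxP => i j lt_ij; rewrite mxE -val_eqE /=.
  rewrite (_ : (j == i :> nat) = false); last by lia.
  by rewrite (_ : (j.+1 == i)%N = false) ?subr0 //; lia.
rewrite -[LHS]mul1r -detL -det_mulmx; congr (\det _).
apply/matrixP => i j; rewrite !mxE.
under eq_bigr => k _ do rewrite mxE mulrBl.
rewrite sumrB; congr (_ - _).
  rewrite (bigD1 i) //= eqxx mul1r big1 ?addr0 // => k /negPf->.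
  by rewrite mul0r.
case: i => [[|i] lt_i] /=.
  by apply: big1 => k _; rewrite mul0r.
rewrite (bigD1 (inord i)) //= inordK ?(ltnW lt_i) // eqxx mul1r.
rewrite big1 ?addr0 // => k; rewrite -val_eqE /= inordK ?(ltnW lt_i) //.
by move=> /negPf nk; rewrite eqSS nk mul0r.
Qed.

(** After the subtraction of consecutive rows, the first column is zero except
    for its first entry, and a difference of two values of [delannoy h.+1] is
    a section of the sum that defines them. *)
Lemma delannoy_det_rec n b0 bs :
  size bs = n -> path leq b0 bs ->
  rows_det n.+1 [seq delannoy^~ b | b <- b0 :: bs] =
  rows_det n (pairmap (fun x y j => \sum_(x <= c < y) hop_row c j) b0 bs).
Proof.
move=> size_bs sorted_b; rewrite /rows_det det_row_differences.
set rows := map _ _.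
have nth_rows k : (k < n.+1)%N ->
    nth (fun=> 0) rows k = delannoy^~ (nth 0%N (b0 :: bs) k).
  by move=> lt_k; rewrite (nth_map 0%N) //= size_bs.
clearbody rows; rewrite (expand_det_col _ ord0) big_ord_recl big1 => [|i _].
  rewrite addr0 !mxE subr0 nth_rows // mul1r /cofactor expr0 mul1r.
  congr (\det _); apply/matrixP => i j.
  have lt_i : (i < n)%N by [].
  rewrite !mxE /= !mxE add0n inordK ?(leqW lt_i) //.
  rewrite !nth_rows ?(leqW lt_i) //.
  rewrite (nth_pairmap 0%N) ?size_bs //=.
  have le_b : (nth 0 (b0 :: bs) i <= nth 0 bs i)%N.
    by move/(pathP 0%N): sorted_b; apply; rewrite size_bs.
  rewrite (@big_cat_nat _ _ _ (nth 0%N (b0 :: bs) i) 0 (nth 0%N bs i)) //=.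
  by rewrite [LHS]addrC addKr.
have lt_i : (i < n)%N by [].
rewrite !mxE /= !mxE add0n inordK ?(leqW lt_i) //.
by rewrite !nth_rows ?(leqW lt_i) // subrr mul0r.
Qed.

(** The Gessel-Viennot determinant satisfies the recursion. When two entries
    of [b] agree, it has two equal rows, in accordance with the value 0 of
    [transfer]. *)
Lemma transfer_rows_det n b :
  size b = n -> sorted leq b ->
  transfer n b = rows_det n [seq delannoy^~ x | x <- b].
Proof.
elim: n b => [|n IH] [|b0 bs] //=; first by rewrite /rows_det det_mx00.
case=> size_bs le_b; case: ifPn => [lt_b|].
  rewrite delannoy_det_rec // -(layer_sum_rows_det (pre := [::])) //=.
  apply: eq_layer_sum => ds ids; apply: IH; last exact: layer_image_sorted ids.
  by rewrite (layer_image_size ids).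
move=> not_lt; apply/esym.
case: (pickP (fun i : 'I_(size bs) => nth 0 bs i <= nth 0 (b0 :: bs) i)%N);
  last first.
  move=> lt_b; case/negP: not_lt; apply/(pathP 0%N) => i lt_i.
  by move: (lt_b (Ordinal lt_i)) => /negbT; rewrite -ltnNge.
case=> i lt_i /= ge_i.
have /(pathP 0%N) /(_ _ lt_i) le_i := le_b.
have eq_i : nth 0%N (b0 :: bs) i = nth 0%N bs i by apply/eqP; rewrite eqn_leq le_i.
apply: (@rows_det_eq_rows _ _ i); first by rewrite ltnS -size_bs.
by move=> j; rewrite -map_cons !(nth_map 0%N) //= ?eq_i // ltnW.
Qed.

End Transfer.

(** * From Delannoy numbers to binomial coefficients *)

Arguments gbin : simpl never.

Lemma gbin0 x : gbin x 0%N = 1.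
Proof. by rewrite /gbin big_ord0 fact0 divr1. Qed.

Lemma gbin_pascal x (k : nat) : gbin (x + 1) k.+1 = gbin x k.+1 + gbin x k.
Proof.
rewrite /gbin big_ord_recl /= subr0.
under eq_bigr => i _ do
  rewrite /bump /= add1n -natr1 opprD addrACA [1 - 1]subrr addr0.
rewrite big_ord_recr /= factS natrM.
have: (k`!)%:R != 0 :> rat by rewrite pnatr_eq0 -lt0n fact_gt0.
have: (k.+1)%:R != 0 :> rat by rewrite pnatr_eq0.
rewrite -natr1; move: (\prod_(i < k) _) k%:R (k`!)%:R => P y f hy hf.
by field; rewrite hf hy.
Qed.

Lemma gbin_diag N : gbin N%:R N = 1.
Proof.
elim: N => [|N IH]; first exact: gbin0.
rewrite -natr1 gbin_pascal IH /gbin /= (bigD1 (Ordinal (ltnSn N))) //=.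
by rewrite subrr !mul0r add0r.
Qed.

(** In terms of generating functions in [M], where [gbin (M + i) M] is the
    coefficient of [1 / (1 - x) ^ (i + 1)]: multiplication by [1 - x] lowers
    the exponent. *)
Lemma gbin_up i M : gbin (M.+1%:R + i.+1%:R) M.+1 =
  gbin (M%:R + i.+1%:R) M + gbin (M.+1%:R + i%:R) M.+1.
Proof.
rewrite [RHS]addrC (_ : M%:R + i.+1%:R = M.+1%:R + i%:R); last first.
  by rewrite -[i.+1%:R]natr1 -[M.+1%:R]natr1; ring.
by rewrite -gbin_pascal -[i.+1%:R]natr1; congr (gbin _ _); ring.
Qed.

(** The counterpart of [gbin_up] for [gbin (M - i) M], which is the
    coefficient of [(1 - x) ^ (i - 1)]. *)
Lemma gbin_down i M : gbin (M.+1%:R - i.+1%:R) M.+1 =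
  gbin (M.+1%:R - i%:R) M.+1 - gbin (M%:R - i%:R) M.
Proof.
apply/eqP; rewrite eq_sym subr_eq; apply/eqP.
rewrite (_ : M%:R - i%:R = M.+1%:R - i.+1%:R); last first.
  by rewrite -[i.+1%:R]natr1 -[M.+1%:R]natr1; ring.
by rewrite -gbin_pascal -[i.+1%:R]natr1; congr (gbin _ _); ring.
Qed.

Section BinomialColumns.
Variable l : rat.

(** The coefficient of [x ^ N] in [(u ^ j + v ^ j) / (1 - x)], where [u = l /
    (1 - x)] and [v = 1 - x]. *)
Definition binomial_column (j N : nat) : rat :=
  l ^+ j * gbin (N%:R + j%:R) N + gbin (N%:R - j%:R) N.

Local Notation hop f c :=
  ((l - 1) * f c + (if (0 < c)%N then f c.-1 else 0)).

Lemma binomial_column_step j N :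
  binomial_column j.+1 N.+1 - binomial_column j.+1 N =
    l ^+ j.+1 * gbin (N.+1%:R + j%:R) N.+1
    + gbin (N.+1%:R - j%:R) N.+1 - gbin (N%:R - j%:R) N
    - gbin (N%:R - j.+1%:R) N.
Proof. by rewrite /binomial_column gbin_up gbin_down; ring. Qed.

Lemma binomial_column0 N : binomial_column 0 N = 2.
Proof. by rewrite /binomial_column mulr0n !addr0 gbin_diag; ring. Qed.

Lemma binomial_column1 N :
  binomial_column 1 N = \sum_(0 <= c < N) hop (fun=> 1) c + (l + 1).
Proof.
elim: N => [|N IH].
  by rewrite big_geq // /binomial_column !gbin0 expr1; ring.
have := binomial_column_step 0 N; rewrite big_nat_recr //= IH.
rewrite !(mulr0n, addr0, subr0) !gbin_diag; case: N {IH} => [|N] /=.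
  by rewrite big_geq // gbin0; lra.
rewrite gbin_down !(mulr0n, subr0) !gbin_diag; lra.
Qed.

(** This is [u ^ (j + 2) + v ^ (j + 2) = (u + v) (u ^ (j + 1) + v ^ (j + 1)) -
    u v (u ^ j + v ^ j)] together with [u v = l] and [u + v = y + l + 1]; the
    sum over [c] is the effect of multiplication by [y = x (l - 1 + x) / (1 -
    x)] on coefficients. *)
Lemma binomial_column_rec j N :
  binomial_column j.+2 N =
    \sum_(0 <= c < N) hop (binomial_column j.+1) c
    + (l + 1) * binomial_column j.+1 N - l * binomial_column j N.
Proof.
elim: N => [|N IH].
  by rewrite big_geq // /binomial_column !gbin0 !exprS; ring.
suff step : binomial_column j.+2 N.+1 - binomial_column j.+2 N =
  hop (binomial_column j.+1) N
  + (l + 1) * (binomial_column j.+1 N.+1 - binomial_column j.+1 N)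
  - l * (binomial_column j N.+1 - binomial_column j N).
  by rewrite big_nat_recr //=; move: step; rewrite IH /=; lra.
rewrite !binomial_column_step; case: N {IH} => [|N].
  by rewrite /binomial_column !gbin_up !gbin_down /= !gbin0 !exprS; ring.
by rewrite /binomial_column /= !gbin_up !gbin_down !exprS; ring.
Qed.

(** The polynomial that expresses [u ^ j + v ^ j] in terms of [y = u + v - (l
    + 1)] when [u v = l]. *)
Fixpoint power_sum_poly (j : nat) : {poly rat} :=
  match j with
  | 0 => 2%:P
  | 1 => 'X + (l + 1)%:P
  | (j'.+1 as j1).+1 =>
      ('X + (l + 1)%:P) * power_sum_poly j1 - l%:P * power_sum_poly j'
  end.

Arguments power_sum_poly : simpl never.

Lemma power_sum_poly_rec j :
  power_sum_poly j.+2 =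
    ('X + (l + 1)%:P) * power_sum_poly j.+1 - l%:P * power_sum_poly j.
Proof. by []. Qed.

Lemma coef_power_sum_poly_rec j h :
  (power_sum_poly j.+2)`_h =
    (if h is h'.+1 then (power_sum_poly j.+1)`_h' else 0)
    + (l + 1) * (power_sum_poly j.+1)`_h - l * (power_sum_poly j)`_h.
Proof.
by rewrite power_sum_poly_rec coefB mulrDl coefD coefXM !coefCM; case: h.
Qed.

Lemma coef_power_sum_poly_gt j h : (j < h)%N -> (power_sum_poly j)`_h = 0.
Proof.
elim/ltn_ind: j h => [[|[|j]]] IH [|h] // lt_jh.
- by rewrite coefC.
- by rewrite coefD coefX coefC eqSS; case: h lt_jh => // h _; rewrite addr0.
rewrite coef_power_sum_poly_rec !IH; try lia; ring.
Qed.

Lemma coef_power_sum_poly_diag j :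
  (power_sum_poly j)`_j = if j is 0 then 2 else 1.
Proof.
elim/ltn_ind: j => [[|[|j]]] IH.
- by rewrite coefC.
- by rewrite coefD coefX coefC addr0.
by rewrite coef_power_sum_poly_rec IH // !coef_power_sum_poly_gt //; ring.
Qed.

Lemma binomial_column_delannoy n j N : (j < n)%N ->
  binomial_column j N =
    \sum_(h < n) (power_sum_poly j)`_h * delannoy (l - 1) h N.
Proof.
have sum0 f : (forall h, (0 < h)%N -> f h = 0) ->
    forall m, \sum_(h < m.+1) f h = f 0%N :> rat.
  by move=> f0 m; rewrite big_ord_recl big1 ?addr0 // => i _; apply: f0.
elim/ltn_ind: j N => [[|[|j]]] IH N; case: n IH => // n IH lt_jn.
- rewrite (sum0 (fun h => (power_sum_poly 0)`_h * delannoy (l - 1) h N)).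
    by rewrite binomial_column0 coefC mulr1.
  by move=> h h_gt0; rewrite coef_power_sum_poly_gt // mul0r.
- case: n IH lt_jn => // n IH _; rewrite binomial_column1 big_ord_recl.
  rewrite (sum0 (fun h => (power_sum_poly 1)`_h.+1 * delannoy (l - 1) h.+1 N)).
    have -> : (power_sum_poly 1)`_1 = 1 by rewrite coefD coefX coefC addr0.
    have -> : (power_sum_poly 1)`_(@ord0 n.+1) = l + 1.
      by rewrite coefD coefX coefC add0r.
    by rewrite [RHS]addrC mul1r; congr (_ + _); rewrite mulr1.
  by move=> h h_gt0; rewrite coef_power_sum_poly_gt // mul0r.
rewrite binomial_column_rec.
under [in RHS]eq_bigr => h _ do
  rewrite coef_power_sum_poly_rec mulrBl mulrDl -!mulrA.
rewrite sumrB [X in _ = X - _]big_split /= -!mulr_sumr -!IH; try lia.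
congr (_ + _ - _); rewrite big_ord_recl mul0r add0r /=.
transitivity (\sum_(0 <= c < N) \sum_(h < n) (power_sum_poly j.+1)`_h *
   hop (delannoy (l - 1) h) c).
  apply: eq_bigr => c _; rewrite !(IH j.+1) //; try lia.
  rewrite !big_ord_recr /= !coef_power_sum_poly_gt ?mul0r ?addr0; try lia.
  case: ifP => _;
    under [in RHS]eq_bigr => h _ do rewrite mulrDr mulrCA ?mulr0 ?addr0.
    by rewrite big_split /= mulr_sumr.
  by rewrite mulr_sumr addr0.
by rewrite exchange_big /=; apply: eq_bigr => h _; rewrite -mulr_sumr add0n.
Qed.

(** The coefficients of [power_sum_poly] form a triangular matrix, whose
    diagonal entries are 2 in column 0 and 1 in all other columns. *)
Lemma det_binomial_columns n (b : nat -> nat) : (0 < n)%N ->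
  \det (\matrix_(i < n, j < n) binomial_column j (b i)) =
  2 * \det (\matrix_(i < n, j < n) delannoy (l - 1) j (b i)).
Proof.
case: n => // n _.
pose T : 'M[rat]_n.+1 := \matrix_(h, j) (power_sum_poly j)`_h.
have detT : \det T = 2.
  rewrite -det_tr det_trig.
    rewrite big_ord_recl big1 ?mulr1 => [|i _]; rewrite !mxE.
      by rewrite coef_power_sum_poly_diag.
    by rewrite coef_power_sum_poly_diag.
  by apply/is_trig_mxP => i j lt_ij; rewrite !mxE coef_power_sum_poly_gt.
rewrite -detT mulrC -det_mulmx; congr (\det _); apply/matrixP => i j.
rewrite !mxE (@binomial_column_delannoy n.+1) //; apply: eq_bigr => h _.
by rewrite !mxE mulrC.
Qed.

End BinomialColumns.

(** * The top level of a Delannoy path *)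

Definition start (m : nat) : point := (- m%:Z, m%:Z).

(** The coordinates are chosen such that, at height [n], position 0 is the
    starting point of the path that starts at this height. A north step
    increases the position by 1 and a northeast step by 2. *)
Definition site (n b : nat) : point := (b%:Z - n%:Z, n%:Z).

(** The pair [(c, e)] stands for a step up to position [c + 1] of the next
    level, which is northeast if [e] holds and north otherwise, followed by
    east steps up to position [b]. The step up starts at position [c - 1] or
    [c], which is [lower (c, e)]. *)
Definition extend (b : nat) (v : seq step) (u : nat * bool) : seq step :=
  rcons v (if u.2 then Northeast else North) ++ nseq (b - u.1.+1) East.

Definition lower (u : nat * bool) : nat := if u.2 then u.1.-1 else u.1.

Lemma foldl_move_east p k : foldl move p (nseq k East) = (p.1 + k%:Z, p.2).
Proof.
elim: k p => [|k IH] [x y] /=; first by rewrite addr0.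
by rewrite IH /=; congr (_, _); lia.
Qed.

Lemma foldl_extend n m b v u :
  (u.1 < b)%N -> (u.2 ==> (0 < u.1)%N) ->
  foldl move (start m) v = site n (lower u) ->
  foldl move (start m) (extend b v u) = site n.+1 b.
Proof.
case: u => c [] /= lt_c c_gt0 E; rewrite /extend foldl_cat foldl_rcons E.
  by rewrite foldl_move_east /site /lower /=; congr (_, _); lia.
by rewrite foldl_move_east /site /lower /=; congr (_, _); lia.
Qed.

(** Hence a path that ends on its starting level has east steps only, and a
    path from position 0 reaches no negative position. *)
Lemma foldl_move_le p v :
  (p.2 <= (foldl move p v).2) &&
  (p.1 + p.2 <= (foldl move p v).1 + (foldl move p v).2).
Proof.
elim: v p => [|s v IH] p /=; first by rewrite !lexx.
have := IH (move p s); case: s => /=; lia.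
Qed.

Lemma vertices_cat p v1 v2 :
  vertices p (v1 ++ v2) = vertices p v1 ++ scanl move (foldl move p v1) v2.
Proof. by rewrite /vertices scanl_cat. Qed.

Lemma mem_vertices p v q :
  q \in vertices p v -> exists v1 v2, v = v1 ++ v2 /\ q = foldl move p v1.
Proof.
elim: v p => [|s v IH] p; first by rewrite inE => /eqP->; exists [::], [::].
rewrite inE => /orP[/eqP->|]; first by exists [::], (s :: v).
by case/IH => v1 [v2 [-> ->]]; exists (s :: v1), v2.
Qed.

Lemma vertices_bounds p v q : q \in vertices p v ->
  [&& p.2 <= q.2, q.2 <= (foldl move p v).2 & p.1 + p.2 <= q.1 + q.2].
Proof.
case/mem_vertices => v1 [v2 [-> ->]]; rewrite foldl_cat.
have /andP[le1 _] := foldl_move_le (foldl move p v1) v2.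
have /andP[le2 le3] := foldl_move_le p v1.
exact/and3P.
Qed.

Lemma mem_vertices_end p v : foldl move p v \in vertices p v.
Proof.
rewrite /vertices; elim: v p => [|s v IH] p /=; first by rewrite inE.
by rewrite inE IH orbT.
Qed.

Lemma mem_scanl_east p k q :
  (q \in scanl move p (nseq k East)) =
  [&& q.2 == p.2, p.1 < q.1 & q.1 <= p.1 + k%:Z].
Proof.
case: q => x y; elim: k p => [|k IH] [px py] /=.
  by rewrite in_nil; lia.
by rewrite inE IH xpair_eqE /=; lia.
Qed.

(** On the new level, the path fills the interval of positions from [u.1 + 1]
    to [b]. *)
Lemma vertices_extend n m b v u q :
  (u.1 < b)%N -> (u.2 ==> (0 < u.1)%N) ->
  foldl move (start m) v = site n (lower u) ->
  (q \in vertices (start m) (extend b v u)) =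
  (q \in vertices (start m) v) ||
  [&& q.2 == n.+1%:Z, u.1.+1%:Z <= q.1 + q.2 & q.1 + q.2 <= b%:Z].
Proof.
move=> lt_c c_gt0 E; rewrite /extend -cats1 -catA vertices_cat mem_cat.
congr (_ || _); rewrite /= inE mem_scanl_east E.
rewrite /lower; case: u lt_c c_gt0 {E} => c [] /= lt_c c_gt0.
  by case: q => x y; rewrite xpair_eqE /=; lia.
by case: q => x y; rewrite xpair_eqE /=; lia.
Qed.

Lemma vertices_east n b q :
  (q \in vertices (start n) (nseq b East)) =
  [&& q.2 == n%:Z, 0 <= q.1 + q.2 & q.1 + q.2 <= b%:Z].
Proof.
by rewrite /vertices inE mem_scanl_east; case: q => x y; rewrite xpair_eqE /=; lia.
Qed.

Lemma horizontal_path n b v :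
  foldl move (start n) v = site n b -> v = nseq b East.
Proof.
rewrite /start /site addrC; move: (- n%:Z) => x.
elim: v x b => [|s v IH] x b /=.
  by case=> ?; have -> : b = 0%N by lia.
case: s => /= E.
- have := foldl_move_le (x + 1, n%:Z) v; rewrite E /= => le_b.
  case: b E le_b => [|b] E le_b; first by lia.
  by rewrite (IH (x + 1) b) // E; congr (_, _); lia.
- by have := foldl_move_le (x, n%:Z + 1) v; rewrite E /=; lia.
- by have := foldl_move_le (x + 1, n%:Z + 1) v; rewrite E /=; lia.
Qed.

(** Read from its end, a path consists of east steps up to its last step
    upwards, which exists because the path starts at a lower height. *)
Lemma last_level n m b v :
  (m <= n)%N -> foldl move (start m) v = site n.+1 b ->
  exists v' u, [/\ v = extend b v' u, (u.1 < b)%N, u.2 ==> (0 < u.1)%N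
    & foldl move (start m) v' = site n (lower u)].
Proof.
move=> le_mn; elim/last_ind: v b => [|v s IH] b.
  by case=> _ ?; lia.
rewrite foldl_rcons; have := foldl_move_le (start m) v.
case E: (foldl move (start m) v) => [x y]; rewrite /start /= => le_v.
case: s => /= -[Ex Ey].
- case: b Ex => [|b] Ex; first by lia.
  have [|v' [u [-> lt_u u_gt0 E']]] := IH b.
    by rewrite E /site; congr (_, _); lia.
  exists v', u; split => //; last by lia.
  rewrite /extend -cats1 -catA; congr (_ ++ _).
  rewrite subSn //.
  by rewrite -[in RHS]addn1 nseqD.
- exists v, (b.-1, false); rewrite /lower /=; split; try lia.
    by rewrite /extend /= prednK ?subnn ?cats0 //; lia.
  by rewrite E /site; congr (_, _); lia.
- exists v, (b.-1, true); rewrite /lower /=; split; try lia.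
    by rewrite /extend /= prednK ?subnn ?cats0 //; lia.
  by rewrite E /site; congr (_, _); lia.
Qed.

(** The number of trailing east steps determines [u.1], and the step before
    them determines [u.2]. *)
Lemma extend_inj b v1 u1 v2 u2 : (u1.1 < b)%N -> (u2.1 < b)%N ->
  extend b v1 u1 = extend b v2 u2 -> v1 = v2 /\ u1 = u2.
Proof.
(* The last step upwards ends the run of east steps read backwards. *)
have runE u v : find (predC1 East) (rev (extend b v u)) = (b - u.1.+1)%N.
  rewrite /extend rev_cat rev_rcons rev_nseq find_cat size_nseq.
  rewrite (_ : has _ _ = false).
    set s := if _ then _ else _.
    have s_ne : s != East by rewrite /s; case: (u.2); apply/eqP.
    by rewrite /= s_ne addn0.
  by apply/negbTE/hasPn => s; rewrite mem_nseq => /andP[_ /eqP->]; rewrite /= eqxx.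
move=> lt1 lt2 eq_ext; have := runE u1 v1; rewrite eq_ext runE => eq_run.
have eq_c : u1.1 = u2.1 by lia.
have eq_size : size v1 = size v2.
  by move: (congr1 size eq_ext); rewrite !size_cat !size_rcons eq_c; lia.
move: eq_ext; rewrite /extend eq_c => /eqP.
rewrite eqseq_cat ?size_rcons ?eq_size // eqxx andbT.
rewrite eqseq_rcons => /andP[/eqP-> /eqP eq_s]; split=> //.
by move: eq_s; case: u1 u2 eq_c {runE lt1 lt2 eq_run} => [c1 []] [c2 []] //= ->.
Qed.

(** * Enumeration of the nonintersecting systems *)

Definition descents (b0 b1 : nat) : seq (nat * bool) :=
  [seq u <- [seq (c, e) | c <- index_iota b0 b1, e <- [:: false; true]]
     | u.2 ==> (0 < u.1)%N].

Lemma mem_descents b0 b1 u :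
  (u \in descents b0 b1) = [&& (b0 <= u.1)%N, (u.1 < b1)%N & u.2 ==> (0 < u.1)%N].
Proof.
case: u => c e; rewrite mem_filter andbC andbA; congr (_ && _).
transitivity (c \in index_iota b0 b1); last exact: mem_index_iota.
apply/allpairsP/idP => [[[c' e'] /= []]|mem_c].
  by move=> mem_c _ [-> _].
by exists (c, e); rewrite mem_c; case: e.
Qed.

Lemma descents_uniq b0 b1 : uniq (descents b0 b1).
Proof.
apply/filter_uniq/allpairs_uniq => //; first exact: iota_uniq.
by move=> [c1 e1] [c2 e2].
Qed.

Fixpoint layer_moves (b0 : nat) (bs : seq nat) : seq (seq (nat * bool)) :=
  if bs is b1 :: bs' then
    [seq u :: us | u <- descents b0 b1, us <- layer_moves b1 bs']
  else [:: [::]].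

Lemma layer_moves_uniq b0 bs : uniq (layer_moves b0 bs).
Proof.
elim: bs b0 => [|b1 bs IH] b0 //=.
apply: allpairs_uniq; [exact: descents_uniq | exact: IH |].
by move=> [u1 us1] [u2 us2] /= _ _ [-> ->].
Qed.

Lemma mem_layer_moves b0 bs us :
  us \in layer_moves b0 bs <->
  size us = size bs /\
  (forall t, (t < size bs)%N ->
     nth (0%N, false) us t \in descents (nth 0%N (b0 :: bs) t) (nth 0%N bs t)).
Proof.
elim: bs b0 us => [|b1 bs IH] b0 us /=.
  by rewrite inE; split=> [/eqP->|[/eqP/nilP->]].
split=> [/allpairsP[[u us'] /= [mem_u /IH[sz mem_us] ->]]|].
  by split=> [/=|[|t]]; rewrite ?sz // ltnS => /mem_us.
case: us => [|u us] [] // [sz] mem_us; apply/allpairsP; exists (u, us).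
split=> //=; first exact: (mem_us 0%N).
by apply/IH; split=> // t lt_t; apply: (mem_us t.+1).
Qed.

Fixpoint extend_all (bs : seq nat) (vs : seq (seq step)) (us : seq (nat * bool))
    : seq (seq step) :=
  match bs, vs, us with
  | b :: bs', v :: vs', u :: us' => extend b v u :: extend_all bs' vs' us'
  | _, _, _ => [::]
  end.

Lemma size_extend_all bs vs us : size vs = size bs -> size us = size bs ->
  size (extend_all bs vs us) = size bs.
Proof.
by elim: bs vs us => [|b bs IH] [|v vs] [|u us] //= [sv] [su]; rewrite IH.
Qed.

Lemma nth_extend_all bs vs us t :
  size vs = size bs -> size us = size bs -> (t < size bs)%N ->
  nth [::] (extend_all bs vs us) t =
  extend (nth 0%N bs t) (nth [::] vs t) (nth (0%N, false) us t).
Proof.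
elim: bs vs us t => [|b bs IH] [|v vs] [|u us] [|t] //= [sv] [su] lt_t.
exact: IH.
Qed.

Lemma extend_all_inj b0 bs vs1 us1 vs2 us2 :
  size vs1 = size bs -> size vs2 = size bs ->
  us1 \in layer_moves b0 bs -> us2 \in layer_moves b0 bs ->
  extend_all bs vs1 us1 = extend_all bs vs2 us2 -> us1 = us2 /\ vs1 = vs2.
Proof.
elim: bs b0 vs1 us1 vs2 us2 => [|b1 bs IH] b0 [|v1 vs1] us1 [|v2 vs2] us2 //=.
  by rewrite !inE => _ _ /eqP-> /eqP->.
move=> [sz1] [sz2] /allpairsP[[u1 us1'] /= [+ mem1 ->]].
rewrite mem_descents => /and3P[_ lt1 _].
move=> /allpairsP[[u2 us2'] /= [+ mem2 ->]].
rewrite mem_descents => /and3P[_ lt2 _] [eq_ext eq_all].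
have [-> ->] := extend_inj lt1 lt2 eq_ext.
by have [-> ->] := IH _ _ _ _ _ sz1 sz2 mem1 mem2 eq_all.
Qed.

(** The word of the path that starts at height [n] comes first, the word of
    the path that starts at height 1 last, in the order of the end points [b].
    *)
Fixpoint systems (n : nat) (b : seq nat) : seq (seq (seq step)) :=
  if n is n'.+1 then
    if b is b0 :: bs then
      if sorted ltn b then
        [seq nseq b0 East :: extend_all bs vs us
           | us <- layer_moves b0 bs, vs <- systems n' (map lower us)]
      else [::]
    else [::]
  else [:: [::]].

Definition system (n : nat) (b : seq nat) (ws : seq (seq step)) : Prop :=
  [/\ sorted ltn b, size ws = n,
     (forall t, (t < n)%N ->
        foldl move (start (n - t)) (nth [::] ws t) = site n (nth 0%N b t))
   & (forall t t' q, (t < n)%N -> (t' < n)%N ->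
        q \in vertices (start (n - t)) (nth [::] ws t) ->
        q \in vertices (start (n - t')) (nth [::] ws t') -> t = t')].

Lemma seq_choice (A B : Type) (a0 : A) (b0 : B) n (P : nat -> A -> B -> Prop) :
  (forall t, (t < n)%N -> exists a b, P t a b) ->
  exists sa sb, [/\ size sa = n, size sb = n &
    forall t, (t < n)%N -> P t (nth a0 sa t) (nth b0 sb t)].
Proof.
elim: n => [|n IH] exP; first by exists [::], [::].
have [t lt_t|sa [sb [sza szb Psab]]] := IH; first by apply: exP; apply: ltnW.
have [a [b Pab]] := exP n (ltnSn n).
exists (rcons sa a), (rcons sb b); rewrite !size_rcons sza szb; split=> // t.
rewrite ltnS leq_eqVlt !nth_rcons sza szb => /orP[/eqP->|lt_t].
  by rewrite ltnn eqxx.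
by rewrite lt_t; apply: Psab.
Qed.

(** A vertex of an extended path lies either below the top level, where
    disjointness is known, or on it, where the path occupies an interval
    ending at its own entry of [b] and lying above all smaller entries. *)
Lemma system_extend n b0 bs vs us :
  size bs = n -> sorted ltn (b0 :: bs) -> us \in layer_moves b0 bs ->
  system n (map lower us) vs ->
  system n.+1 (b0 :: bs) (nseq b0 East :: extend_all bs vs us).
Proof.
move=> size_bs lt_b /mem_layer_moves[size_us mem_us].
case=> _ size_vs end_vs disj_vs.
have us_ok t : (t < n)%N -> [/\ (nth 0 (b0 :: bs) t <= (nth (0, false) us t).1)%N,
    ((nth (0, false) us t).1 < nth 0 bs t)%N &
    (nth (0, false) us t).2 ==> (0 < (nth (0, false) us t).1)]%N.
  by rewrite -size_bs => /mem_us; rewrite mem_descents => /and3P.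
have end_v t : (t < n)%N -> foldl move (start (n - t)) (nth [::] vs t) =
    site n (lower (nth (0%N, false) us t)).
  by move=> lt_t; rewrite end_vs // (nth_map (0%N, false)) ?size_us ?size_bs.
have nth_ext t : (t < n)%N -> nth [::] (extend_all bs vs us) t =
    extend (nth 0%N bs t) (nth [::] vs t) (nth (0%N, false) us t).
  by move=> lt_t; apply: nth_extend_all; rewrite ?size_us ?size_vs ?size_bs.
have vert_t t q : (t < n.+1)%N ->
    q \in vertices (start (n.+1 - t))
            (nth [::] (nseq b0 East :: extend_all bs vs us) t) ->
    (exists t1, [/\ t = t1.+1, q.2 <= n%:Z &
       q \in vertices (start (n - t1)) (nth [::] vs t1)]) \/
    [/\ q.2 = n.+1%:Z, q.1 + q.2 <= (nth 0%N (b0 :: bs) t)%:Z &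
       forall s, (s < t)%N -> (nth 0%N (b0 :: bs) s)%:Z < q.1 + q.2].
  case: t => [_|t lt_t].
    by rewrite subn0 [nth _ _ _]/= vertices_east => /and3P[/eqP h_q _ le_q]; right.
  have [ge_c lt_c c_gt0] := us_ok t lt_t.
  rewrite /= subSS nth_ext // (vertices_extend _ lt_c c_gt0 (end_v t lt_t)).
  case/orP => [mem_q|/and3P[/eqP h_q ge_q le_q]].
    left; exists t; split=> //; have /and3P[_ + _] := vertices_bounds mem_q.
    by rewrite end_v.
  right; split=> // s lt_s.
  apply: lt_le_trans ge_q; rewrite ltz_nat ltnS; apply: leq_trans ge_c.
  apply: (sorted_leq_nth leq_trans leqnn); rewrite ?inE /= ?size_bs; try lia.
  by apply: sub_path lt_b => x y; apply: ltnW.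
split=> //; first by rewrite /= size_extend_all ?size_us ?size_vs ?size_bs.
  case=> [_|t lt_t].
    by rewrite subn0 foldl_move_east /= /start /site addrC.
  have [ge_c lt_c c_gt0] := us_ok t lt_t.
  by rewrite /= subSS nth_ext //; apply: foldl_extend => //; apply: end_v.
move=> t t' q lt_t lt_t' /(vert_t _ _ lt_t) mem_q /(vert_t _ _ lt_t') mem_q'.
case: mem_q mem_q' => [[t1 [E1 h1 mem1]]|[h1 le1 ge1]];
  case=> [[t2 [E2 h2 mem2]]|[h2 le2 ge2]].
- by rewrite E1 E2; congr _.+1; apply: disj_vs mem1 mem2; lia.
- by rewrite h2 in h1; lia.
- by rewrite h1 in h2; lia.
- case: (ltngtP t t') => // [/ge2|/ge1] lt_q.
    by have := lt_le_trans lt_q le1; rewrite ltxx.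
  by have := lt_le_trans lt_q le2; rewrite ltxx.
Qed.

(** If a path entered the top level below or at the end point of the previous
    path, it would run over that end point; so the entries interlace with [b].
    Similarly, the lower end points are strictly increasing because they are
    distinct vertices of disjoint paths. *)
Lemma system_last_level n b0 bs ws :
  size bs = n -> system n.+1 (b0 :: bs) ws ->
  exists us vs, [/\ us \in layer_moves b0 bs, system n (map lower us) vs &
    ws = nseq b0 East :: extend_all bs vs us].
Proof.
move=> size_bs [lt_b]; case: ws => [|w0 ws] // [size_ws] end_ws disj_ws.
have w0E : w0 = nseq b0 East by apply: horizontal_path (end_ws 0%N _).
have [t lt_t|vs [us [size_vs size_us vuP]]] :=
    @seq_choice _ _ [::] (0%N, false) n (fun t v u =>
  [/\ nth [::] ws t = extend (nth 0%N bs t) v u, (u.1 < nth 0%N bs t)%N,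
      u.2 ==> (0 < u.1)%N & foldl move (start (n - t)) v = site n (lower u)]).
  apply: last_level; first by rewrite leq_subr.
  by rewrite -subSS (end_ws t.+1).
have vert_t t q : (t < n)%N ->
    (q \in vertices (start (n.+1 - t.+1)) (nth [::] (w0 :: ws) t.+1)) =
    (q \in vertices (start (n - t)) (nth [::] vs t)) ||
    [&& q.2 == n.+1%:Z, (nth (0%N, false) us t).1.+1%:Z <= q.1 + q.2 &
        q.1 + q.2 <= (nth 0%N bs t)%:Z].
  move=> lt_t; have [/= -> lt_c c_gt0 end_v] := vuP t lt_t.
  by rewrite subSS (vertices_extend _ lt_c c_gt0 end_v).
have ge_c t : (t < n)%N -> (nth 0 (b0 :: bs) t <= (nth (0, false) us t).1)%N.
  move=> lt_t; rewrite leqNgt; apply/negP => lt_c.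
  have lt_bt : (nth 0 (b0 :: bs) t < nth 0 bs t)%N.
    by move/(pathP 0%N): lt_b; apply; rewrite size_bs.
  have /n_Sn [] : t = t.+1.
  apply: (disj_ws t t.+1 (site n.+1 (nth 0%N (b0 :: bs) t))) => //; first lia.
    by rewrite -end_ws ?mem_vertices_end //; lia.
  by rewrite vert_t //; apply/orP; right; rewrite /site /= eqxx /=; lia.
have disj_vs t t' q : (t < n)%N -> (t' < n)%N ->
     q \in vertices (start (n - t)) (nth [::] vs t) ->
     q \in vertices (start (n - t')) (nth [::] vs t') -> t = t'.
  move=> lt_t lt_t' mem_q mem_q'; apply/eqP; rewrite -eqSS; apply/eqP.
  by apply: (disj_ws _ _ q); rewrite ?vert_t ?mem_q ?mem_q'.
have nth_lower t : (t < n)%N ->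
    nth 0%N (map lower us) t = lower (nth (0%N, false) us t).
  by move=> lt_t; rewrite (nth_map (0%N, false)) ?size_us.
exists us, vs; split.
- apply/mem_layer_moves; rewrite size_us size_bs; split=> // t lt_t.
  by rewrite mem_descents ge_c //=; case: (vuP t lt_t) => _ -> ->.
- split=> //; last by move=> t lt_t; rewrite nth_lower //; case: (vuP t lt_t).
  apply/(sortedP 0%N) => t; rewrite size_map size_us => lt_t.
  have [_ lt_c _ end_t] := vuP t (ltnW lt_t).
  have [_ _ _ end_t'] := vuP t.+1 lt_t.
  have ge_c' := ge_c t.+1 lt_t; rewrite /= in ge_c'.
  rewrite !nth_lower //; last exact: ltnW.
  have /eqP ne_d : lower (nth (0%N, false) us t) <> lower (nth (0%N, false) us t.+1).
    move=> eq_d; have /n_Sn [] : t = t.+1.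
    apply: (disj_vs _ _ (site n (lower (nth (0%N, false) us t)))) => //.
    - exact: ltnW.
    - by rewrite -end_t mem_vertices_end.
    - by rewrite eq_d -end_t' mem_vertices_end.
  move: ne_d; rewrite /lower; case: ifP; case: ifP => _ _; lia.
- rewrite w0E; congr (_ :: _); apply: (@eq_from_nth _ [::]).
    by rewrite size_extend_all ?size_vs ?size_us ?size_bs.
  rewrite size_ws => t lt_t; rewrite nth_extend_all ?size_vs ?size_us ?size_bs //.
  by case: (vuP t lt_t).
Qed.

(** Together with [systems_uniq], this turns a sum over systems into a sum
    over the list [systems n b]. *)
Lemma mem_systems n b ws :
  size b = n -> ws \in systems n b <-> system n b ws.
Proof.
elim: n b ws => [|n IH] [|b0 bs] ws //=.
  move=> _; rewrite inE; split=> [/eqP->|[_ /eqP/nilP -> _ _] //].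
  by split.
case=> size_bs; case: ifPn => [lt_b|nlt_b]; last first.
  by split=> // -[lt_b]; rewrite -[path _ _ _]/(sorted ltn (b0 :: bs)) lt_b in nlt_b.
split=> [/allpairsPdep[us [vs [mem_us mem_vs ->]]]|].
  have [size_us _] := (mem_layer_moves _ _ _).1 mem_us.
  by apply: system_extend => //; apply/IH; rewrite // size_map size_us.
case/(system_last_level size_bs) => us [vs [mem_us sys_vs ->]].
have [size_us _] := (mem_layer_moves _ _ _).1 mem_us.
apply/allpairsPdep; exists us, vs; split=> //.
by apply/IH; rewrite // size_map size_us.
Qed.

Lemma systems_uniq n b : size b = n -> uniq (systems n b).
Proof.
elim: n b => [|n IH] [|b0 bs] //= [size_bs]; case: ifP => // _.
have size_lower us : us \in layer_moves b0 bs -> size (map lower us) = n.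
  by case/mem_layer_moves => + _; rewrite size_map size_bs.
apply: allpairs_uniq_dep; first exact: layer_moves_uniq.
  by move=> us /size_lower; apply: IH.
move=> _ _ /allpairsPdep[us1 [vs1 [mem1 sys1 ->]]]
       /allpairsPdep[us2 [vs2 [mem2 sys2 ->]]] /= [eq_ext].
have [_ + _ _] := (mem_systems _ (size_lower _ mem1)).1 sys1.
have [_ + _ _] := (mem_systems _ (size_lower _ mem2)).1 sys2.
rewrite -size_bs => sz2 sz1.
by have [-> ->] := extend_all_inj sz1 sz2 mem1 mem2 eq_ext.
Qed.

(** * The weighted sum over path systems *)

Section PathSum.
Variables (R : comNzRingType) (w : R).

Definition north_weight (ws : seq (seq step)) : R :=
  \prod_(v <- ws) w ^+ count_mem North v.

Definition move_weight (us : seq (nat * bool)) : R :=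
  \prod_(u <- us) (if u.2 then 1 else w).

Lemma sum_layer_moves b0 bs K :
  \sum_(us <- layer_moves b0 bs) move_weight us * K (map lower us) =
  layer_sum w b0 bs K.
Proof.
elim: bs b0 K => [|b1 bs IH] b0 K /=.
  by rewrite big_seq1 /move_weight big_nil mul1r.
rewrite big_allpairs_dep /= big_filter.
rewrite (big_mkcond (fun u : nat * bool => u.2 ==> (0 < u.1)%N)) big_allpairs_dep /=.
apply: eq_bigr => c _; rewrite !big_cons big_nil addr0 /=; congr (_ + _).
  rewrite -IH mulr_sumr; apply: eq_bigr => us _.
  by rewrite /move_weight big_cons mulrA.
case: ifP => // _; rewrite -IH; apply: eq_bigr => us _.
by rewrite /move_weight big_cons mul1r.
Qed.

Lemma north_weight_extend_all bs vs us :
  size vs = size bs -> size us = size bs ->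
  north_weight (extend_all bs vs us) = move_weight us * north_weight vs.
Proof.
rewrite /north_weight /move_weight.
have east k : count_mem North (nseq k East) = 0%N.
  by rewrite count_nseq /= (_ : East == North = false) ?mul0n //; apply/eqP.
elim: bs vs us => [|b bs IH] [|v vs] [|u us] //=.
  by rewrite !big_nil mulr1.
move=> [sv] [su]; rewrite !big_cons IH // mulrACA; congr (_ * _).
rewrite /extend count_cat east addn0 -cats1 count_cat exprD mulrC /= addn0.
congr (_ * _); case: (u.2).
  by rewrite (_ : Northeast == North = false) //; apply/eqP.
by rewrite eqxx.
Qed.

Lemma sum_systems n b : size b = n ->
  \sum_(ws <- systems n b) north_weight ws = transfer w n b.
Proof.
elim: n b => [|n IH] [|b0 bs] //=.
  by rewrite big_seq1 /north_weight big_nil.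
case=> size_bs; case: ifP => _; last by rewrite big_nil.
have size_lower us : us \in layer_moves b0 bs -> size (map lower us) = n.
  by case/mem_layer_moves => + _; rewrite size_map size_bs.
rewrite big_allpairs_dep -sum_layer_moves [LHS]big_seq [RHS]big_seq.
apply: eq_bigr => us mem_us; have size_us := size_lower us mem_us.
rewrite -IH // mulr_sumr [LHS]big_seq [RHS]big_seq.
apply: eq_bigr => vs /(mem_systems _ size_us)[_ size_vs _ _].
rewrite size_map in size_us.
rewrite /north_weight big_cons -/(north_weight _) north_weight_extend_all ?size_bs //.
rewrite count_nseq /= (_ : East == North = false) ?mul0n ?expr0 ?mul1r //.
exact/eqP.
Qed.

(** The partition is read from its last to its first part, so that the list
    increases. *)
Definition profile n (lam : n.-tuple nat) : seq nat :=
  [seq (tnth lam (rev_ord t) + t)%N | t <- enum 'I_n].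

Lemma nth_profile n (lam : n.-tuple nat) (t : 'I_n) :
  nth 0%N (profile lam) t = (tnth lam (rev_ord t) + t)%N.
Proof.
by rewrite (nth_map t) ?size_enum_ord // nth_ord_enum.
Qed.

Lemma size_profile n (lam : n.-tuple nat) : size (profile lam) = n.
Proof. by rewrite size_map size_enum_ord. Qed.

(** Every step increases the position; so the bound on the lengths of words in
    [path_tuple] excludes no path. *)
Lemma size_path_le m n b v : foldl move (start m) v = site n b -> (size v <= b)%N.
Proof.
(* A step adds 1 or 2 to the sum of the coordinates. *)
have le_size p : p.1 + p.2 + (size v)%:Z <=
    (foldl move p v).1 + (foldl move p v).2.
  elim: v p => [|s v IH] [x y] /=; first by rewrite addr0.
  by apply: le_trans (IH _); case: s => /=; lia.
by move=> E; have := le_size (start m); rewrite E /=; lia.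
Qed.

Definition words_of n (lam : n.-tuple nat) (p : path_tuple lam) : seq (seq step) :=
  [seq (p (rev_ord t) : seq step) | t <- enum 'I_n].

Lemma nth_words_of n (lam : n.-tuple nat) (p : path_tuple lam) (t : 'I_n) :
  nth [::] (words_of p) t = p (rev_ord t).
Proof. by rewrite (nth_map t) ?size_enum_ord // nth_ord_enum. Qed.

Lemma words_of_inj n (lam : n.-tuple nat) : injective (@words_of n lam).
Proof.
move=> p p' eq_p; apply/ffunP => i; apply/val_inj.
by rewrite -[i]rev_ordK /= -!nth_words_of eq_p.
Qed.

Lemma path_start_rev n (t : 'I_n) : path_start (rev_ord t) = start (n - t).
Proof. by rewrite /path_start /start /= -subSn // subSS. Qed.

Lemma path_end_rev n (lam : n.-tuple nat) (t : 'I_n) :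
  path_end lam (rev_ord t) = site n (nth 0%N (profile lam) t).
Proof.
rewrite /path_end /site nth_profile /=; congr (_, _).
have := ltn_ord t; lia.
Qed.

Lemma nonintersecting_systemP n (lam : n.-tuple nat) (p : path_tuple lam) :
  sorted ltn (profile lam) ->
  reflect (system n (profile lam) (words_of p)) (nonintersecting_system p).
Proof.
move=> lt_lam; apply: (iffP andP) => [[/forallP ends /forallP disj]|].
  split=> //; first by rewrite size_map size_enum_ord.
    move=> t lt_t; pose t' := Ordinal lt_t.
    rewrite -[t]/(val t') nth_words_of -path_start_rev -path_end_rev.
    exact/eqP.
  move=> t t' q lt_t lt_t'.
  rewrite -[t]/(val (Ordinal lt_t)) -[t']/(val (Ordinal lt_t')).
  rewrite !nth_words_of -!path_start_rev => mem_q mem_q'.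
  apply/eqP; rewrite val_eqE; apply: contraT => ne_t.
  have /forallP/(_ (rev_ord (Ordinal lt_t')))/implyP :=
    disj (rev_ord (Ordinal lt_t)).
  rewrite (inj_eq rev_ord_inj) => /(_ ne_t) /hasPn /(_ _ mem_q).
  by rewrite /= mem_q'.
case=> _ _ ends disj; split; apply/forallP => i.
  rewrite -[i]rev_ordK path_start_rev path_end_rev -nth_words_of.
  by rewrite ends.
apply/forallP => j; apply/implyP => ne_ij; apply/hasPn => q mem_q.
apply: contra ne_ij => /= mem_q'; rewrite -(inj_eq rev_ord_inj) -val_eqE.
apply/eqP; apply: (disj _ _ q); try exact: ltn_ord.
  by rewrite nth_words_of -path_start_rev !rev_ordK.
by rewrite nth_words_of -path_start_rev !rev_ordK.
Qed.

Lemma delannoy_sum_transfer n (lam : n.-tuple nat) :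
  (forall i, tnth lam i <= head 0 lam)%N -> sorted ltn (profile lam) ->
  delannoy_sum lam 1 w 1 = transfer w n (profile lam).
Proof.
move=> le_lam lt_lam; rewrite -sum_systems ?size_profile //.
have perm_sys : perm_eq (systems n (profile lam))
    [seq words_of p | p : path_tuple lam <- enum (@nonintersecting_system n lam)].
  apply: uniq_perm; first exact/systems_uniq/size_profile.
    by rewrite map_inj_uniq ?enum_uniq //; apply: words_of_inj.
  move=> ws; apply/idP/mapP => [/(mem_systems _ (size_profile lam)) sys|[p]].
    have [_ size_ws ends _] := sys.
    pose p : path_tuple lam := [ffun i => insub_bseq _ (nth [::] ws (rev_ord i))].
    have wsE : ws = words_of p.
      apply: (@eq_from_nth _ [::]); first by rewrite size_map size_enum_ord.
      rewrite size_ws => t lt_t; rewrite -[t]/(val (Ordinal lt_t)) nth_words_of.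
      rewrite ffunE rev_ordK /insub_bseq insubdK //.
      apply: leq_trans (size_path_le (ends t lt_t)) _.
      rewrite -[t in X in (X <= _)%N]/(val (Ordinal lt_t)) nth_profile.
      by rewrite leq_add // ltnW.
    by exists p => //; rewrite mem_enum; apply/(nonintersecting_systemP _ lt_lam);
      rewrite -wsE.
  rewrite mem_enum => /(nonintersecting_systemP _ lt_lam) + ->.
  by move/(mem_systems _ (size_profile lam)).
rewrite (perm_big _ perm_sys) big_map big_enum /=.
apply: eq_big => // p _; rewrite !expr1n mul1r mulr1.
rewrite /north_weight big_map big_enum /= prodrXr; congr (w ^+ _).
by rewrite [LHS](reindex_inj rev_ord_inj).
Qed.

End PathSum.

(** * Removing a domino from a tiling *)

Definition squares (d : domino) : {fset point} :=
  [fset first_square d; second_square d]%fset.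

Lemma mem_squares d c : (c \in squares d) = covers d c.
Proof. by rewrite in_fset2. Qed.

(** A form of [is_tiling] free of cardinalities. A square covered by a domino
    of [T] lies in [D] by the first clause, which is why the last one ranges
    over all squares. *)
Lemma is_tilingP (D : {fset point}) (T : {fset domino}) :
  reflect
    [/\ (forall d c, d \in T -> covers d c -> c \in D),
        (forall c, c \in D -> exists2 d, d \in T & covers d c)
      & (forall c d d', d \in T -> d' \in T ->
           covers d c -> covers d' c -> d = d')]
    (is_tiling D T).
Proof.
apply: (iffP andP) => [[/allP inD /allP cov]|[inD cov uniq_cov]].
  have inD' d c : d \in T -> covers d c -> c \in D.
    by move=> /inD /andP[mem1 mem2] /orP[] /eqP->.
  split=> // [c /cov /cardfs1P [d dE]|c d d' mem_d mem_d' cov_d cov_d'].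
    have: d \in [fset d in T | covers d c]%fset by rewrite dE inE.
    by rewrite !inE => /andP[]; exists d.
  have /cardfs1P [d0 d0E] := cov c (inD' _ _ mem_d cov_d).
  have: d \in [fset d in T | covers d c]%fset by rewrite !inE mem_d.
  have: d' \in [fset d in T | covers d c]%fset by rewrite !inE mem_d'.
  by rewrite d0E !inE => /eqP-> /eqP->.
split; [apply/allP => d mem_d | apply/allP => c mem_c].
  by rewrite !(inD d) // /covers eqxx ?orbT.
have [d mem_d cov_d] := cov c mem_c.
apply/cardfs1P; exists d; apply/fsetP => d'; rewrite !inE.
apply/andP/eqP => [[mem_d' cov_d']|->]; last by [].
exact: (uniq_cov c).
Qed.

Lemma tiling_add D (d0 : domino) T :
  {subset squares d0 <= D} -> is_tiling (D `\` squares d0)%fset T ->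
  is_tiling D (d0 |` T)%fset.
Proof.
move=> sub_d0 /is_tilingP[inD cov uniq_cov].
have notin d c : d \in T -> covers d c -> covers d0 c -> False.
  by move=> mem_d cov_d cov0; have := inD d c mem_d cov_d;
    rewrite inE mem_squares cov0.
apply/is_tilingP; split.
- move=> d c; rewrite !inE => /orP[/eqP-> cov_c|mem_d cov_c].
    by apply: sub_d0; rewrite mem_squares.
  by have := inD d c mem_d cov_c; rewrite inE => /andP[].
- move=> c mem_c; case: (boolP (covers d0 c)) => cov0.
    by exists d0; rewrite // !inE eqxx.
  have [|d mem_d cov_d] := cov c; first by rewrite inE mem_squares cov0.
  by exists d; rewrite // !inE mem_d orbT.
- move=> c d d'; rewrite !inE => /orP[/eqP->|mem_d] /orP[/eqP->|mem_d'] //.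
  + by move=> cov0 cov_d'; case: (notin d' c).
  + by move=> cov_d cov0; case: (notin d c).
  exact: uniq_cov.
Qed.

Lemma tiling_remove D (d0 : domino) T :
  d0 \in T -> is_tiling D T -> is_tiling (D `\` squares d0)%fset (T `\ d0)%fset.
Proof.
move=> mem0 /is_tilingP[inD cov uniq_cov]; apply/is_tilingP; split.
- move=> d c; rewrite !inE => /andP[ne_d mem_d] cov_d.
  rewrite (inD d c mem_d cov_d) andbT -/(squares d0).
  apply: contra ne_d => cov0; apply/eqP; apply: (uniq_cov c) => //.
- move=> c; rewrite inE mem_squares => /andP[ncov0 /cov[d mem_d cov_d]].
  exists d => //; rewrite !inE mem_d andbT.
  by apply: contra ncov0 => /eqP <-.
- by move=> c d d'; rewrite !inE => /andP[_ mem_d] /andP[_ mem_d']; apply: uniq_cov.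
Qed.

Section DominoSum.
Variables (R : comNzRingType) (w : R).

Definition domino_weight (d : domino) : R := if domino2 d then w else 1.

Definition tiling_sum (D : {fset point}) : R := domino_sum 1 w 1 D.

Definition tiling_weight (T : {fset domino}) : R :=
  w ^+ #|` [fset d in T | domino2 d]%fset|.

Lemma tiling_sumE D : tiling_sum D =
  \sum_(T <- fpowerset (D `*` [fset false; true])%fset | is_tiling D T)
    tiling_weight T.
Proof. by apply: eq_bigr => T _; rewrite !expr1n mul1r mulr1. Qed.

Lemma tiling_weight_add d T : d \notin T ->
  tiling_weight (d |` T)%fset = domino_weight d * tiling_weight T.
Proof.
move=> notin_d; rewrite /tiling_weight /domino_weight.
case: ifP => d2; last first.
  rewrite mul1r; congr (_ ^+ #|` _|); apply/fsetP => d'; rewrite !inE.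
  by case: eqP => // ->; rewrite d2 /= (negPf notin_d).
rewrite -exprS; congr (_ ^+ _).
rewrite (_ : [fset d0 in d |` T | _]%fset = d |` [fset d in T | domino2 d])%fset.
  by rewrite cardfsU1 !inE (negPf notin_d).
apply/fsetP => d'; rewrite !inE.
by case: eqP => // ->; rewrite d2.
Qed.

Lemma is_tiling_fpowerset D T :
  is_tiling D T -> T \in fpowerset (D `*` [fset false; true])%fset.
Proof.
case/is_tilingP => inD _ _; rewrite fpowersetE; apply/fsubsetP => -[c v] mem_d.
rewrite in_fsetM /= !inE; apply/andP; split; last by case: v {mem_d}.
by apply: (inD _ _ mem_d); rewrite /covers eqxx.
Qed.

(** Adding and removing [d] are inverse bijections between the tilings of [D]
    that contain [d] and those of the rest of [D]. *)
Lemma tiling_sum_fix D (d : domino) : {subset squares d <= D} ->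
  \sum_(T <- fpowerset (D `*` [fset false; true])%fset | is_tiling D T && (d \in T))
    tiling_weight T =
  domino_weight d * tiling_sum (D `\` squares d)%fset.
Proof.
move=> sub_d; rewrite tiling_sumE mulr_sumr -[LHS]big_filter -[RHS]big_filter.
set s := [seq T <- _ | is_tiling _ _ && _]; set s' := filter _ _.
have notin T : T \in s' -> d \notin T.
  rewrite mem_filter => /andP[/is_tilingP[inD _ _] _]; apply/negP => mem_d.
  by have := inD d d.1 mem_d; rewrite inE mem_squares /covers eqxx => /(_ isT).
have perm_s : perm_eq s [seq (d |` T)%fset | T <- s'].
  apply: uniq_perm; first exact/filter_uniq/fset_uniq.
    rewrite map_inj_in_uniq; first exact/filter_uniq/fset_uniq.
    move=> T T' /notin nT /notin nT' eq_T.
    by rewrite -(fsetU1K nT) -(fsetU1K nT') eq_T.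
  move=> T; rewrite mem_filter; apply/andP/mapP => [[/andP[tT mem_d] _]|[T' + ->]].
    exists (T `\ d)%fset; last by rewrite fsetD1K.
    have tT' := tiling_remove mem_d tT.
    by rewrite mem_filter tT' is_tiling_fpowerset.
  rewrite mem_filter => /andP[/(tiling_add sub_d) tT _].
  by rewrite tT is_tiling_fpowerset // !inE eqxx.
rewrite (perm_big _ perm_s) big_map [LHS]big_seq [RHS]big_seq.
by apply: eq_bigr => T /notin nT; rewrite tiling_weight_add.
Qed.

Definition dominoes_at (c : point) : seq domino :=
  [:: (c, true); (c, false); ((c.1, c.2 - 1), true); ((c.1 - 1, c.2), false)].

Lemma mem_dominoes_at c d : (d \in dominoes_at c) = covers d c.
Proof.
case: d c => [[dx dy] v] [x y]; rewrite !inE /covers /first_square /second_square.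
by case: v; rewrite /= !xpair_eqE /= ?eqxx; lia.
Qed.

Lemma dominoes_at_uniq c : uniq (dominoes_at c).
Proof. by case: c => x y; rewrite /= !inE !xpair_eqE /=; lia. Qed.

(** Exactly one of the four dominoes at [c] belongs to a given tiling. *)
Lemma tiling_sum_peel D c : c \in D ->
  tiling_sum D = \sum_(d <- dominoes_at c)
    if (first_square d \in D) && (second_square d \in D)
    then domino_weight d * tiling_sum (D `\` squares d)%fset else 0.
Proof.
move=> mem_c; rewrite tiling_sumE.
transitivity (\sum_(T <- fpowerset (D `*` [fset false; true])%fset | is_tiling D T)
   \sum_(d <- dominoes_at c | d \in T) tiling_weight T).
  apply: eq_bigr => T /is_tilingP[_ /(_ c mem_c)[d mem_d cov_d] uniq_cov].
  rewrite big_mkcond (bigD1_seq d) ?dominoes_at_uniq ?mem_dominoes_at //=.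
  rewrite mem_d big_seq_cond big1 ?addr0 // => d' /andP[].
  rewrite mem_dominoes_at => cov_d' ne_d; case: ifP => // mem_d'.
  by case/eqP: ne_d; apply: (uniq_cov c).
rewrite (exchange_big_dep xpredT) //=; apply: eq_bigr => d _.
case: ifP => [/andP[mem1 mem2]|notin_d].
  by apply: tiling_sum_fix => c'; rewrite mem_squares => /orP[] /eqP->.
rewrite big_pred0 // => T; apply/negbTE/negP => /andP[/is_tilingP[inD _ _] mem_d].
by move: notin_d; rewrite !(inD d) // /covers eqxx ?orbT.
Qed.

Lemma tiling_sum0 : tiling_sum fset0 = 1.
Proof.
rewrite tiling_sumE (_ : (_ `*` _)%fset = fset0); last first.
  by apply/fsetP => -[c v]; rewrite in_fsetM !inE.
rewrite fpowerset0 big_mkcond big_seq_fset1 /=.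
rewrite /tiling_weight (_ : [fset d in _ | _]%fset = fset0).
  by rewrite cardfs0 expr0.
by apply/fsetP => d; rewrite !inE.
Qed.

(** * Domains described diagonal by diagonal *)

Definition cell (k i : nat) : point := (i%:Z, i%:Z - k%:Z).

Lemma cell_inj k i k' i' : (cell k i == cell k' i') = (k == k') && (i == i').
Proof. by rewrite xpair_eqE; lia. Qed.

Definition diagonal (M k : nat) (A : pred nat) : seq point :=
  [seq cell k i | i <- iota 0 (M + uphalf k) & A i].

Lemma mem_diagonal M k A k' i :
  (cell k' i \in diagonal M k A) = [&& k' == k, A i & (i < M + uphalf k)%N].
Proof.
apply/mapP/and3P => [[i']|[/eqP-> Ai lt_i]].
  rewrite mem_filter mem_iota => /andP[Ai lt_i] /eqP.
  by rewrite cell_inj => /andP[-> /eqP->].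
by exists i => //; rewrite mem_filter Ai mem_iota.
Qed.

(** All of the diagonals below [k], the squares of diagonal [k] in [A], and
    those of diagonal [k + 1] in [S]. The matching of the outer diagonal with
    the one before it takes squares away from [A] and [S] until [S] is empty.
    *)
Definition stack (M k : nat) (A S : pred nat) : {fset point} :=
  [fset c in flatten [seq diagonal M j predT | j <- iota 0 k]
             ++ diagonal M k A ++ diagonal M k.+1 S]%fset.

Lemma mem_stack M k A S k' i : (cell k' i \in stack M k A S) =
  (i < M + uphalf k')%N &&
  [|| (k' < k)%N, (k' == k) && A i | (k' == k.+1) && S i].
Proof.
rewrite in_fset /= !mem_cat !mem_diagonal.
have -> : (cell k' i \in flatten [seq diagonal M j predT | j <- iota 0 k]) =
    (k' < k)%N && (i < M + uphalf k')%N.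
  apply/flatten_mapP/andP => [[j]|[lt_k lt_i]].
    by rewrite mem_iota mem_diagonal => lt_j /and3P[/eqP-> _ ->].
  by exists k'; rewrite ?mem_iota // mem_diagonal eqxx.
have subst_k j (B : bool) :
    [&& k' == j, B & (i < M + uphalf j)%N] =
    [&& k' == j, B & (i < M + uphalf k')%N] by case: eqP => // ->.
rewrite !subst_k; move: (i < M + _)%N => b.
by case: b; rewrite ?andbT ?andbF.
Qed.

Lemma stack_cell M k A S c : c \in stack M k A S -> exists k' i, c = cell k' i.
Proof.
rewrite in_fset /= !mem_cat => /or3P[/flatten_mapP[j _]| |] /mapP[i _ ->].
- by exists j, i.
- by exists k, i.
- by exists k.+1, i.
Qed.

Lemma eq_cells (D1 D2 : {fset point}) :
  (forall c, c \in D1 -> exists k i, c = cell k i) ->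
  (forall c, c \in D2 -> exists k i, c = cell k i) ->
  (forall k i, (cell k i \in D1) = (cell k i \in D2)) -> D1 = D2.
Proof.
move=> cells1 cells2 eq_D; apply/fsetP => c; apply/idP/idP => mem_c.
  by have [k [i cE]] := cells1 c mem_c; rewrite cE -eq_D -cE.
by have [k [i cE]] := cells2 c mem_c; rewrite cE eq_D -cE.
Qed.

Lemma eq_stack M k A S A' S' :
  (forall i, (i < M + uphalf k)%N -> A i = A' i) ->
  (forall i, (i < M + uphalf k.+1)%N -> S i = S' i) ->
  stack M k A S = stack M k A' S'.
Proof.
move=> eqA eqS; apply: eq_cells => [c|c|k' i]; try exact: stack_cell.
rewrite !mem_stack; case: ltnP => //= lt_i.
congr [|| _, _ | _]; first by case: eqP => // E; rewrite eqA -?E.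
by case: eqP => // E; rewrite eqS -?E.
Qed.

(** Once the outer diagonal is used up, the diagonal before it takes its
    place. *)
Lemma stack_shift M k A :
  stack M k.+1 A pred0 = stack M k predT A.
Proof.
apply: eq_cells => [c|c|k' i]; try exact: stack_cell.
by rewrite !mem_stack /=; congr (_ && _); case: (A i); lia.
Qed.

Definition excluding (A : pred nat) (i : nat) : pred nat :=
  fun j => (j != i) && A j.

Lemma stack_excluding M k A S d i j :
  (forall k' i', covers d (cell k' i') =
     ((k' == k.+1) && (i' == i)) || ((k' == k) && (i' == j))) ->
  (stack M k A S `\` squares d)%fset = stack M k (excluding A j) (excluding S i).
Proof.
move=> cov_d; apply: eq_cells => [c|c|k' i']; try exact: stack_cell.
  by rewrite inE => /andP[_]; apply: stack_cell.
rewrite inE mem_squares cov_d !mem_stack /excluding.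
case: (i' < _)%N; rewrite ?andbF ?andbT //=.
case: (ltngtP k' k) => [lt_k|gt_k|->].
- by rewrite (_ : (k' == k.+1) = false) //; lia.
- by case: eqP => //= _; rewrite orbF.
rewrite (_ : (k == k.+1) = false) /=; last by lia.
by rewrite !orbF.
Qed.

Lemma domino2_cell k i : domino2 (cell k.+1 i, true) = odd k.
Proof.
rewrite /domino2 /white /gray /= opprB addrCA subrr addr0 negbK.
rewrite (_ : i%:Z - (i%:Z - k.+1%:Z + 1) = k%:Z); last by lia.
by rewrite -[(2 %| k.+1%:Z)%Z]/(2 %| k.+1)%N -[(2 %| k%:Z)%Z]/(2 %| k)%N !dvdn2 /=;
  case: (odd k).
Qed.

(** A square of the outer diagonal has only two neighbours inside the domain,
    the one above it and the one to its left. The domino towards the former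
    has weight [w] if the outer diagonal is white. *)
Lemma tiling_sum_stack_peel M k (A S : pred nat) i :
  (i < M + uphalf k.+1)%N -> S i ->
  tiling_sum (stack M k A S) =
  (if (i < M + uphalf k)%N && A i then
     (if odd k then w else 1) *
       tiling_sum (stack M k (excluding A i) (excluding S i))
   else 0) +
  (if (0 < i)%N && A i.-1 then
     tiling_sum (stack M k (excluding A i.-1) (excluding S i))
   else 0).
Proof.
move=> lt_i Si; have mem_c : cell k.+1 i \in stack M k A S.
  by rewrite mem_stack lt_i Si eqxx !orbT.
rewrite (tiling_sum_peel mem_c) !big_cons big_nil !addr0.
rewrite /first_square /second_square /=.
have -> : (i%:Z, i%:Z - k.+1%:Z + 1) = cell k i by congr (_, _); lia.
have -> : (i%:Z + 1, i%:Z - k.+1%:Z) = cell k.+2 i.+1 by congr (_, _); lia.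
have -> : (i%:Z, i%:Z - k.+1%:Z - 1) = cell k.+2 i by congr (_, _); lia.
have out j : (cell k.+2 j \in stack M k A S) = false.
  rewrite mem_stack; lia.
rewrite mem_c !out /= !add0r; congr (_ + _).
  have -> : (cell k i \in stack M k A S) = (i < M + uphalf k)%N && A i.
    by rewrite mem_stack eqxx ltnn (_ : (k == k.+1) = false) ?orbF //; lia.
  case: ifP => // _; congr (_ * _); first by rewrite /domino_weight domino2_cell.
  congr (tiling_sum _); apply: stack_excluding => k' i'.
  rewrite /covers /first_square /second_square /=.
  have -> : (i%:Z, i%:Z - k.+1%:Z + 1) = cell k i by congr (_, _); lia.
  by rewrite !cell_inj.
have -> : (i%:Z - 1 + 1, i%:Z - k.+1%:Z) = cell k.+1 i by congr (_, _); lia.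
rewrite mem_c andbT; case: posnP => [i0|i_gt0] /=.
  rewrite ifF //; apply/negbTE/negP => /stack_cell[k' [i' []]]; lia.
have -> : (i%:Z - 1, i%:Z - k.+1%:Z) = cell k i.-1 by congr (_, _); lia.
have -> : (cell k i.-1 \in stack M k A S) = A i.-1.
  rewrite mem_stack eqxx ltnn (_ : (k == k.+1) = false) ?orbF /=; last by lia.
  rewrite andbC (_ : (_ < _)%N) ?andbT //.
  by move: lt_i; rewrite uphalfE /= uphalf_half; lia.
rewrite /domino_weight /domino2 /= mul1r.
case: ifP => // _; congr (tiling_sum _); apply: stack_excluding => k' i'.
rewrite /covers /first_square /second_square /=.
have -> : (i.-1%:Z + 1, i.-1%:Z - k%:Z) = cell k.+1 i by congr (_, _); lia.
by rewrite !cell_inj orbC.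
Qed.

End DominoSum.

(** * Matching one diagonal with the next *)

Section HalfLayers.
Variables (R : comNzRingType) (w : R).

Fixpoint interlacing_sum (b0 : nat) (bs : seq nat) (K : seq nat -> R) : R :=
  if bs is b1 :: bs' then
    \sum_(b0 <= c < b1) interlacing_sum b1 bs' (fun cs => K (c :: cs))
  else K [::].

Fixpoint hop_sum (cs : seq nat) (K : seq nat -> R) : R :=
  if cs is c :: cs' then
    w * hop_sum cs' (fun ds => K (c :: ds)) +
    (if (0 < c)%N then hop_sum cs' (fun ds => K (c.-1 :: ds)) else 0)
  else K [::].

Fixpoint interlaces (b0 : nat) (bs cs : seq nat) : bool :=
  match bs, cs with
  | [::], [::] => true
  | b1 :: bs', c :: cs' => [&& (b0 <= c)%N, (c < b1)%N & interlaces b1 bs' cs']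
  | _, _ => false
  end.

Lemma eq_interlacing_sum b0 bs K K' :
  (forall cs, interlaces b0 bs cs -> K cs = K' cs) ->
  interlacing_sum b0 bs K = interlacing_sum b0 bs K'.
Proof.
elim: bs b0 K K' => [|b1 bs IH] b0 K K' eK /=; first exact: eK.
apply: eq_big_nat => c /andP[le_c lt_c].
by apply: IH => cs ics; apply: eK; rewrite /= le_c lt_c.
Qed.

Lemma interlacing_sum_linear b0 bs a K K' :
  interlacing_sum b0 bs (fun cs => a * K cs + K' cs) =
  a * interlacing_sum b0 bs K + interlacing_sum b0 bs K'.
Proof.
elim: bs b0 K K' => [|b1 bs IH] b0 K K' //=.
by rewrite mulr_sumr -big_split /=; apply: eq_bigr => c _; rewrite IH.
Qed.

Lemma eq_hop_sum cs K K' : K =1 K' -> hop_sum cs K = hop_sum cs K'.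
Proof.
elim: cs K K' => [|c cs IH] K K' eK /=; first exact: eK.
by congr (_ * _ + _); [| case: ifP => // _]; apply: IH => ds; apply: eK.
Qed.

Lemma hop_sum0 cs K : (forall ds, K ds = 0) -> hop_sum cs K = 0.
Proof.
elim: cs K => [|c cs IH] K K0 /=; first exact: K0.
rewrite !IH ?mulr0 ?if_same ?addr0 // => ds; exact: K0.
Qed.

(** The two matchings make up one step of the recursion: first [c] is chosen,
    then [d]. *)
Lemma interlacing_hop_sum b0 bs K :
  interlacing_sum b0 bs (fun cs => hop_sum cs K) = layer_sum w b0 bs K.
Proof.
elim: bs b0 K => [|b1 bs IH] b0 K //=.
apply: eq_bigr => c _; rewrite interlacing_sum_linear IH; congr (_ + _).
case: ifP => _; first exact: IH.
rewrite -[RHS](mul0r (interlacing_sum b1 bs (fun=> 0))) -[RHS]addr0.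
rewrite -[X in _ = _ + X](mul0r (interlacing_sum b1 bs (fun=> 0))).
elim: bs {IH} b1 => [|b2 bs IHb] b1 /=; first by rewrite !mul0r addr0.
rewrite big1 => [|c' _]; first by rewrite !mul0r addr0.
by rewrite IHb !mul0r addr0.
Qed.

Lemma interlaces_path b0 bs cs c :
  interlaces b0 bs cs -> (c < b0)%N -> path ltn c cs.
Proof.
elim: bs b0 cs c => [|b1 bs IH] b0 [|c' cs] c //= /and3P[le_c lt_c ics] lt_c0.
by rewrite (leq_trans lt_c0) //= (IH b1).
Qed.

Lemma interlaces_sorted b0 bs cs : interlaces b0 bs cs -> sorted ltn cs.
Proof.
case: bs cs => [|b1 bs] [|c cs] //= /and3P[_ lt_c ics].
exact: interlaces_path ics lt_c.
Qed.

Lemma interlaces_lt m b0 bs cs : interlaces b0 bs cs ->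
  {in bs, forall b, b <= m}%N -> {in cs, forall c, c < m}%N.
Proof.
elim: bs b0 cs => [|b1 bs IH] b0 [|c cs] //= /and3P[_ lt_c ics] le_m c'.
rewrite inE => /orP[/eqP->|].
  by apply: leq_trans lt_c _; apply: le_m; rewrite mem_head.
by apply: (IH b1) ics _ c' => b mem_b; apply: le_m; rewrite inE mem_b orbT.
Qed.

Lemma layer_image_lt m b0 bs ds : layer_image b0 bs ds ->
  {in bs, forall b, b <= m}%N -> {in ds, forall d, d < m}%N.
Proof.
elim: bs b0 ds => [|b1 bs IH] b0 [|d ds] //= /and3P[_ lt_d ids] le_m d'.
rewrite inE => /orP[/eqP->|].
  by apply: leq_trans lt_d _; apply: le_m; rewrite mem_head.
by apply: (IH b1) ids _ d' => b mem_b; apply: le_m; rewrite inE mem_b orbT.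
Qed.

Local Notation stack_sum M k A S := (tiling_sum w (stack M k A S)).

(** The white squares [cs] are matched from left to right. The square [c]
    cannot be blocked from above, since the squares used so far, collected in
    [pre], are smaller; for [c > 0] it is blocked on its left exactly when the
    choice would repeat an entry of [pre], and these are the terms without
    [uniq]. *)
Lemma white_layer M k pre cs :
  odd k -> sorted ltn cs -> uniq pre ->
  {in cs, forall c, c < M + uphalf k}%N ->
  {in pre & cs, forall p c, p < c}%N ->
  stack_sum M k [predC pre] (mem cs) =
  hop_sum cs (fun ds => if uniq (pre ++ ds)
                        then stack_sum M k [predC pre ++ ds] pred0 else 0).
Proof.
move=> odd_k; elim: cs pre => [|c cs IH] pre sorted_cs uniq_pre lt_cs lt_pre.
  by rewrite /= cats0 uniq_pre; congr (tiling_sum _ _); apply: eq_stack.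
have lt_c : (c < M + uphalf k)%N by apply: lt_cs; rewrite mem_head.
have notin_cs : c \notin cs.
  by have := sorted_uniq ltn_trans ltnn sorted_cs => /= /andP[].
have sorted_cs' := path_sorted sorted_cs.
have c_lt c' : c' \in cs -> (c < c')%N.
  by move: sorted_cs => /= /(order_path_min ltn_trans)/allP; apply.
have step p : p \notin pre -> (p <= c)%N ->
    stack_sum M k (excluding [predC pre] p) (excluding (mem (c :: cs)) c) =
    hop_sum cs (fun ds => if uniq (pre ++ p :: ds)
      then stack_sum M k [predC pre ++ p :: ds] pred0 else 0).
  move=> notin_p le_p.
  transitivity (stack_sum M k [predC rcons pre p] (mem cs)).
    congr (tiling_sum _ _); apply: eq_stack => i _; rewrite /excluding /=.
      by rewrite mem_rcons inE negb_or.
    by rewrite inE; case: eqP => // ->; rewrite (negPf notin_cs).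
  rewrite IH //.
  - by apply: eq_hop_sum => ds; rewrite !cat_rcons.
  - by rewrite rcons_uniq notin_p.
  - by move=> c' mem_c'; apply: lt_cs; rewrite inE mem_c' orbT.
  - move=> p' c'; rewrite mem_rcons inE => /orP[/eqP->|mem_p'] mem_c'.
      exact: leq_ltn_trans le_p (c_lt _ mem_c').
    by apply: lt_pre; rewrite // inE mem_c' orbT.
have notin_c : c \notin pre.
  by apply/negP => /lt_pre/(_ (mem_head _ _)); rewrite ltnn.
have lt_c' : (c < M + uphalf k.+1)%N.
  by apply: leq_trans lt_c _; rewrite leq_add2l uphalfE /= uphalf_half; lia.
have mem_c : mem (c :: cs) c by exact: mem_head.
rewrite (tiling_sum_stack_peel _ _ lt_c' mem_c).
rewrite lt_c odd_k /= notin_c step //; congr (_ + _).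
case: posnP => //= c_gt0; case: (boolP (c.-1 \in pre)) => /= mem_c1; last first.
  by rewrite step // leq_pred.
(* The square on the left is taken, and all terms with d = c - 1 vanish. *)
rewrite hop_sum0 // => ds; rewrite cat_uniq /= mem_c1 /=.
by rewrite !andbF.
Qed.

(** Without a square on its left, a gray square is matched with the one above
    it, which takes away the left neighbour of the next gray square. *)
Lemma forced_right M k (A S : pred nat) p q :
  ~~ odd k -> (p = 0%N \/ ~~ A p.-1) -> (p <= q <= M + uphalf k)%N ->
  (forall i, (p <= i < q)%N -> A i && S i) ->
  stack_sum M k A S =
  stack_sum M k (fun i => ~~ (p <= i < q)%N && A i)
                (fun i => ~~ (p <= i < q)%N && S i).
Proof.
move=> even_k; have [d] := ubnP (q - p)%N.
elim: d p A S => // d IH p A S; rewrite ltnS => le_d p_ok le_pq memAS.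
case: (ltngtP p q) le_pq => [lt_pq /= le_q|lt_qp|eq_pq _]; first last.
- congr (tiling_sum _ _); apply: eq_stack => i _;
    by rewrite (_ : (_ <= _ < _)%N = false) //; lia.
- by rewrite andbC /= => /andP[]; lia.
have /andP[Ap Sp] : A p && S p by apply: memAS; rewrite leqnn.
have uphalf_k : uphalf k.+1 = (uphalf k).+1.
  by rewrite uphalfE /= uphalf_half (negPf even_k).
rewrite (@tiling_sum_stack_peel _ _ _ _ _ _ p) //; last by rewrite uphalf_k; lia.
rewrite (leq_trans lt_pq le_q) Ap (negPf even_k) mul1r /= [X in _ + X]ifF; last first.
  by case: p_ok => [->|/negPf->]; rewrite ?andbF.
rewrite addr0 (IH p.+1).
- congr (tiling_sum _ _); apply: eq_stack => i _; rewrite /excluding.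
    by rewrite andbA; congr (_ && _); lia.
  by rewrite andbA; congr (_ && _); lia.
- lia.
- by right; rewrite /excluding /= eqxx.
- lia.
- move=> i lt_i; rewrite /excluding (_ : (i == p) = false) /=; last by lia.
  by apply: memAS; lia.
Qed.

(** The mirror image of [forced_right], working from the right end. *)
Lemma forced_left M k (A S : pred nat) p q :
  (q < M + uphalf k.+1)%N ->
  ~~ (q < M + uphalf k)%N || ~~ A q -> (p <= q)%N ->
  (forall i, (p <= i < q)%N -> A i && S i.+1) ->
  stack_sum M k A S =
  stack_sum M k (fun i => ~~ (p <= i < q)%N && A i)
                (fun i => ~~ (p < i <= q)%N && S i).
Proof.
elim: q A S => [|q IH] A S lt_q noAq le_pq memAS.
  congr (tiling_sum _ _); apply: eq_stack => i _.
    by rewrite (_ : (_ <= _ < _)%N = false) //; lia.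
  by rewrite (_ : (_ < _ <= _)%N = false) //; lia.
case: (ltngtP p q.+1) le_pq => // [lt_pq _|-> _]; last first.
  congr (tiling_sum _ _); apply: eq_stack => i _.
    by rewrite (_ : (_ <= _ < _)%N = false) //; lia.
  by rewrite (_ : (_ < _ <= _)%N = false) //; lia.
have /andP[Aq Sq] : A q && S q.+1 by apply: memAS; lia.
rewrite (@tiling_sum_stack_peel _ _ _ _ _ _ q.+1) //= Aq ifF ?add0r; last first.
  by apply/negbTE; rewrite negb_and.
rewrite IH; try lia.
- congr (tiling_sum _ _); apply: eq_stack => i _; rewrite /excluding.
    by rewrite andbA; congr (_ && _); lia.
  by rewrite andbA; congr (_ && _); lia.
- by rewrite /excluding eqxx orbT.
- move=> i lt_i; rewrite /excluding.
  have -> : i != q by lia.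
  by apply: memAS; lia.
Qed.

(** Between two consecutive bullets [p < q] there are [q - p - 1] gray squares
    with [q - p] white neighbours. The white square [c] that stays free splits
    them: the gray squares up to [c] are matched to the left, the others
    upwards. *)
Lemma gray_run M k (A S : pred nat) p q :
  ~~ odd k -> (p < q <= M + uphalf k)%N ->
  (forall i, (p <= i < q)%N -> A i) ->
  (forall i, (p < i < q)%N -> S i) ->
  stack_sum M k A S =
  \sum_(p <= c < q)
    stack_sum M k (fun i => (i == c) || ~~ (p <= i < q)%N && A i)
                  (fun i => ~~ (p < i < q)%N && S i).
Proof.
move=> even_k; have [d] := ubnP (q - p)%N.
elim: d p A S => // d IH p A S; rewrite ltnS => le_d /andP[lt_pq le_q] memA memS.
have uphalf_k : uphalf k.+1 = (uphalf k).+1.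
  by rewrite uphalfE /= uphalf_half (negPf even_k).
rewrite big_ltn //; case: (ltngtP p.+1 q) lt_pq => // [lt_pq _|eq_pq _]; last first.
  rewrite -eq_pq big_geq // addr0; congr (tiling_sum _ _).
  apply: eq_stack => i _; last by rewrite (_ : (_ < _ < _)%N = false) //; lia.
  case: (eqVneq i p) => [->|ne_ip] /=; first by rewrite memA //; lia.
  by rewrite (_ : (_ <= _ < _)%N = false) //; lia.
have Sp : S p.+1 by apply: memS; lia.
have Ap : A p by apply: memA; lia.
have Ap1 : A p.+1 by apply: memA; lia.
rewrite (@tiling_sum_stack_peel _ _ _ _ _ _ p.+1) //; last by rewrite uphalf_k; lia.
rewrite (leq_trans lt_pq le_q) Ap1 (negPf even_k) mul1r /= Ap; congr (_ + _).
  rewrite (@forced_right _ _ _ _ p.+2 q) //; try lia.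
  - congr (tiling_sum _ _); apply: eq_stack => i _; rewrite /excluding.
      case: (eqVneq i p) => [->|ne_ip] /=; first by rewrite Ap; lia.
      by rewrite andbA; congr (_ && _); lia.
    by rewrite andbA; congr (_ && _); lia.
  - by right; rewrite /excluding /= eqxx.
  - move=> i lt_i; rewrite /excluding memA ?memS; lia.
rewrite (IH p.+1); try lia.
- apply: eq_big_nat => c lt_c; congr (tiling_sum _ _).
  apply: eq_stack => i _; rewrite /excluding.
    by congr (_ || _); rewrite andbA; congr (_ && _); lia.
  by rewrite andbA; congr (_ && _); lia.
- by move=> i lt_i; rewrite /excluding memA; lia.
- by move=> i lt_i; rewrite /excluding memS; lia.
Qed.
End HalfLayers.

(** * Removing two diagonals from a Type 1 domain *)

Section Layers.
Variables (R : comNzRingType) (w : R).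

Local Notation stack_sum M k A S := (tiling_sum w (stack M k A S)).

(** Induction over the bullets. The squares left of [b0] have been dealt with,
    and [pre] collects the white squares left free there; after the last
    bullet, every gray square is matched to the left because no white square
    is above the last one. *)
Lemma gray_runs M k pre b0 bs :
  ~~ odd k -> sorted ltn (b0 :: bs) ->
  {in b0 :: bs, forall b, b <= M + uphalf k}%N ->
  {in pre, forall p, p < b0}%N ->
  stack_sum M k (fun i => (i \in pre) || (b0 <= i)%N)
                (fun i => (b0 < i)%N && (i \notin bs)) =
  interlacing_sum b0 bs (fun cs => stack_sum M k (mem (pre ++ cs)) pred0).
Proof.
move=> even_k; elim: bs b0 pre => [|b1 bs IH] b0 pre sorted_b le_b lt_pre /=.
  have uphalf_k : uphalf k.+1 = (uphalf k).+1.
    by rewrite uphalfE /= uphalf_half (negPf even_k).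
  have le_b0 : (b0 <= M + uphalf k)%N by apply: le_b; rewrite mem_head.
  rewrite (@forced_left _ _ _ _ _ _ b0 (M + uphalf k)) //; first last.
  - by move=> i lt_i /=; lia.
  - by rewrite ltnn.
  - by rewrite uphalf_k; lia.
  congr (tiling_sum _ _); apply: eq_stack => i lt_i /=.
    rewrite cats0; case: (boolP (i \in pre)) => [/lt_pre|] /=; lia.
  by lia.
have /= /andP[lt_b01 sorted_b1] := sorted_b.
have le_b1 : (b1 <= M + uphalf k)%N by apply: le_b; rewrite !inE eqxx orbT.
have notin_bs : b1 \notin bs.
  by have := sorted_uniq ltn_trans ltnn sorted_b => /= /and3P[].
have lt_bs i : i \in bs -> (b1 < i)%N.
  by move: sorted_b1 => /(order_path_min ltn_trans)/allP; apply.
rewrite (@gray_run _ _ _ _ _ _ b0 b1) //; first last.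
- move=> i lt_i; rewrite inE; case: (boolP (i \in bs)) => [/lt_bs|] /=; lia.
- by move=> i lt_i; lia.
- by rewrite lt_b01.
apply: eq_big_nat => c lt_c.
transitivity (stack_sum M k (fun i => (i \in rcons pre c) || (b1 <= i)%N)
                (fun i => (b1 < i)%N && (i \notin bs))).
  congr (tiling_sum _ _); apply: eq_stack => i _ /=.
    rewrite mem_rcons inE -orbA; congr (_ || _).
    by case: (boolP (i \in pre)) => [/lt_pre|] /=; lia.
  by rewrite inE; case: (i \in bs); lia.
rewrite IH //.
- by apply: eq_interlacing_sum => cs _; rewrite cat_rcons.
- by move=> b mem_b; apply: le_b; rewrite inE mem_b orbT.
- move=> p; rewrite mem_rcons inE => /orP[/eqP->|/lt_pre]; lia.
Qed.

(** Before the first bullet, every gray square is matched upwards, since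
    nothing is on the left of square 0. *)
Lemma gray_layer M k b0 bs :
  ~~ odd k -> sorted ltn (b0 :: bs) ->
  {in b0 :: bs, forall b, b <= M + uphalf k}%N ->
  stack_sum M k predT [predC b0 :: bs] =
  interlacing_sum b0 bs (fun cs => stack_sum M k (mem cs) pred0).
Proof.
move=> even_k sorted_b le_b; have le_b0 := le_b b0 (mem_head _ _).
have lt_bs i : i \in bs -> (b0 < i)%N.
  by move: sorted_b => /= /(order_path_min ltn_trans)/allP; apply.
rewrite (@forced_right _ _ _ _ _ _ 0 b0) //; [| by left |]; last first.
  move=> i lt_i; rewrite /= inE; case: (boolP (i \in bs)) => [/lt_bs|] /=; lia.
rewrite -(@gray_runs _ _ [::]) //; congr (tiling_sum _ _).
apply: eq_stack => i _ /=; first by lia.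
by rewrite inE; case: (boolP (i \in bs)) => [/lt_bs|] /=; lia.
Qed.

(** By [gray_layer] and then [white_layer], the diagonals [2 n + 1] and [2 n]
    are matched away, and the squares that the latter uses become the bullets
    of diagonal [2 n - 1]. *)
Lemma tiling_sum_transfer M n b :
  size b = n.+1 -> sorted ltn b -> {in b, forall x, x < M + n.+1}%N ->
  stack_sum M (n * 2) predT [predC b] = transfer w n.+1 b.
Proof.
elim: n b => [|n IH] [|b0 bs] // [size_bs] sorted_b lt_b.
  rewrite gray_layer //; last by move=> x /lt_b; rewrite addn0 addn1.
  case: bs size_bs {sorted_b lt_b} => //= _; rewrite -[RHS](tiling_sum0 w).
  congr (tiling_sum _ _); apply: eq_cells => [c|c|k i]; first exact: stack_cell.
    by rewrite inE.
  by rewrite mem_stack inE /= !andbF.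
have half_k : uphalf (n.+1 * 2) = n.+1 by rewrite muln2 uphalf_double.
have half_k' : uphalf (n * 2).+1 = n.+1 by rewrite muln2 uphalfE /= doubleK.
rewrite gray_layer //; first last.
- by move=> x /lt_b; rewrite half_k addnS ltnS.
- by rewrite muln2 odd_double.
have le_bs : {in bs, forall x, x <= M + n.+1}%N.
  by move=> x mem_x; have := lt_b x; rewrite inE mem_x orbT addnS ltnS; apply.
transitivity (interlacing_sum b0 bs (fun cs => hop_sum w cs (fun ds =>
    if uniq ds then stack_sum M (n * 2) predT [predC ds] else 0))).
  apply: eq_interlacing_sum => cs ics; rewrite mulSn stack_shift.
  transitivity (stack_sum M (n * 2).+1 [predC [::]] (mem cs)).
    by congr (tiling_sum _ _); apply: eq_stack.
  rewrite white_layer //.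
  - by apply: eq_hop_sum => ds /=; case: ifP => // _; rewrite stack_shift.
  - by rewrite /= muln2 odd_double.
  - exact: interlaces_sorted ics.
  - by rewrite half_k'; apply: interlaces_lt ics le_bs.
transitivity (layer_sum w b0 bs (transfer w n.+1)); last first.
  by move: sorted_b => /= ->.
rewrite interlacing_hop_sum; apply: eq_layer_sum => ds ids.
have size_ds : size ds = n.+1 by rewrite (layer_image_size ids).
have lt_dsE : sorted ltn ds = uniq ds.
  by rewrite ltn_sorted_uniq_leq (layer_image_sorted ids) andbT.
rewrite -lt_dsE; case: ifP => [lt_ds|nlt_ds].
  by apply: IH => //; apply: layer_image_lt ids le_bs.
by case: ds nlt_ds {ids size_ds lt_dsE} => //= d ds ->.
Qed.

End Layers.

(** * The boundary encoding *)

Definition bullets (mu : seq nat) : seq nat :=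
  mkseq (fun t => nth 0 mu t + t)%N (size mu).

Lemma bullets_cons x mu : bullets (x :: mu) = x :: map succn (bullets mu).
Proof.
rewrite /bullets /mkseq /= addn0 (iotaDl 1) -!map_comp; congr (_ :: _).
by apply: eq_map => t /=; rewrite addnS.
Qed.

Lemma bullets_ge p mu x : path leq p mu -> x \in bullets mu -> (p <= x)%N.
Proof.
elim: mu p x => [|y mu IH] p x //=; rewrite bullets_cons inE.
move=> /andP[le_py le_mu] /orP[/eqP-> //|/mapP[z mem_z ->]].
by apply: leq_trans le_py (leqW (IH _ _ le_mu mem_z)).
Qed.

(** Generalised to a word that starts after the first [p] circles, as needed
    for the induction. *)
Lemma nth_boundary_encoding p mu i : path leq p mu ->
  nth false
    (flatten (pairmap (fun x y => rcons (nseq (y - x) false) true) p mu)) i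
  = ((i + p)%N \in bullets mu).
Proof.
elim: mu p i => [|x mu IH] p i /=; first by rewrite nth_nil.
case/andP=> le_px le_mu; rewrite bullets_cons inE cat_rcons nth_cat size_nseq.
case: ltnP => [lt_i|le_i].
  rewrite nth_nseq lt_i; apply/esym/negbTE; rewrite negb_or.
  apply/andP; split; first by lia.
  by apply/mapP => -[z /(bullets_ge le_mu)]; lia.
case: (ltngtP i (x - p)%N) le_i => // [gt_i _|-> _]; last first.
  by rewrite subnn subnK // eqxx.
rewrite (_ : (i + p == x)%N = false) /=; last by lia.
rewrite -[(i - _)%N]prednK /=; last by lia.
rewrite IH // -(mem_map succn_inj) (_ : _.+1 = i + p)%N //; lia.
Qed.

Lemma profile_bullets n (lam : n.-tuple nat) : profile lam = bullets (rev lam).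
Proof.
apply: (@eq_from_nth _ 0%N); rewrite size_profile.
  by rewrite size_mkseq size_rev size_tuple.
move=> t lt_t; rewrite -[t in LHS]/(val (Ordinal lt_t)) nth_profile.
rewrite nth_mkseq ?size_rev ?size_tuple // nth_rev ?size_tuple //.
by rewrite (tnth_nth 0%N).
Qed.

Lemma type1_domain_stack n (lam : n.+1.-tuple nat) :
  sorted leq (rev lam) ->
  type1_domain lam =
  stack (head 0%N lam) (n * 2) predT [predC profile lam].
Proof.
move=> sorted_lam; set M := head 0%N lam.
have kE : (2 * n.+1 - 1 = (n * 2).+1)%N by lia.
have halfE : uphalf (n * 2).+1 = n.+1 by rewrite muln2 uphalfE /= doubleK.
have encE i : nth false (boundary_encoding lam) i = (i \in profile lam).
  rewrite /boundary_encoding nth_boundary_encoding ?addn0 ?profile_bullets //.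
  by case: (rev lam) sorted_lam.
have proto k i : (cell k i \in prototypical_domain M (n * 2).+1) =
    (k <= (n * 2).+1)%N && (i < M + uphalf k)%N.
  rewrite in_fset; apply/allpairsPdep/andP => [[k' [i' []]]|[le_k lt_i]].
    rewrite !mem_iota => lt_k lt_i /eqP; rewrite -/(cell k' i') cell_inj.
    by move=> /andP[/eqP-> /eqP->].
  by exists k, i; rewrite !mem_iota.
apply: eq_cells => [c|c|k i]; last 1 first.
- rewrite /type1_domain -/M kE inE proto mem_stack.
  rewrite [_ \in [fset _ in _]%fset]in_fset /=.
  have -> : (cell k i \in [seq (i%:Z, i%:Z - (n * 2).+1%:Z)
      | i <- iota 0 (M + n.+1) & nth false (boundary_encoding lam) i]) =
      [&& k == (n * 2).+1, i \in profile lam & (i < M + n.+1)%N].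
    have := mem_diagonal M (n * 2).+1 (mem (profile lam)) k i.
    rewrite /diagonal halfE => <-.
    by congr (_ \in map _ _); apply: eq_filter => j; rewrite encE.
  case: (ltngtP k (n * 2).+1) => [lt_k|gt_k|->].
  + by rewrite andbT /= ; lia.
  + have -> : (k < n * 2)%N = false by lia.
    have -> : (k == n * 2)%N = false by lia.
    by rewrite /= andbF.
  have -> : ((n * 2).+1 < n * 2)%N = false by lia.
  have -> : ((n * 2).+1 == n * 2)%N = false by lia.
  by rewrite halfE /=; case: (i < _)%N; case: (i \in _).
- rewrite /type1_domain -/M kE inE => /andP[_].
  rewrite in_fset => /allpairsPdep[k [i [_ _ ->]]]; by exists k, i.
- exact: stack_cell.
Qed.

(** * The theorem *)

Lemma profile_lambda_sr s r n :
  profile (lambda_sr s r n) = mkseq (fun t => s.+1 * t + r)%N n.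
Proof.
apply: (@eq_from_nth _ 0%N); rewrite size_profile ?size_mkseq // => t lt_t.
rewrite -[t in LHS]/(val (Ordinal lt_t)) nth_profile tnth_mktuple nth_mkseq //=.
rewrite mulSn (_ : (n - 1 - (n - t.+1))%N = t); lia.
Qed.

Lemma sorted_mkseq (f : nat -> nat) n :
  {homo f : x y / (x < y)%N} -> sorted ltn (mkseq f n).
Proof.
move=> f_homo; rewrite /mkseq sorted_map.
by apply: sub_sorted (iota_ltn_sorted 0 n) => x y; apply: f_homo.
Qed.

Theorem theorem1p1 (m a : nat) (l : int) (n : nat)
    (hm : (1 <= m)%N) (hn : (1 <= n)%N) :
  domino_D 1 ((l - 1)%:~R : rat) 1 (m - 1) a n
    = delannoy_L 1 ((l - 1)%:~R : rat) 1 (m - 1) a n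
  /\ delannoy_L 1 ((l - 1)%:~R : rat) 1 (m - 1) a n
    = 1 / 2%:R *
      \det (\matrix_(i < n, j < n)
        (l%:~R ^+ j * gbin (m * i + j + a)%N%:R (m * i + a)%N%:Z
         + gbin ((m * i + a)%N%:R - j%:R) (m * i + a)%N%:Z)).
Proof.
case: m hm => // s _; case: n hn => // n _; rewrite subn1 /=.
set lam := lambda_sr s a n.+1; set w := (l - 1)%:~R.
have profileE : profile lam = mkseq (fun t => s.+1 * t + a)%N n.+1.
  exact: profile_lambda_sr.
have nth_lam i : (i < n.+1)%N -> nth 0%N lam i = (s * (n - i) + a)%N.
  move=> lt_i; rewrite -[i in LHS]/(val (Ordinal lt_i)) -tnth_nth tnth_mktuple.
  by rewrite subn1.
have head_lam : head 0%N lam = (s * n + a)%N by rewrite -nth0 nth_lam ?subn0.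
have sorted_b : sorted ltn (profile lam).
  rewrite profileE; apply: sorted_mkseq => x y lt_xy.
  by rewrite ltn_add2r ltn_pmul2l.
have pathsE : delannoy_L 1 w 1 s a n.+1 = transfer w n.+1 (profile lam).
  apply: delannoy_sum_transfer => // i; rewrite -/lam head_lam tnth_mktuple.
  by rewrite leq_add2r leq_mul // subn1 leq_subr.
have tilingsE : domino_D 1 w 1 s a n.+1 = transfer w n.+1 (profile lam).
  rewrite /domino_D type1_domain_stack; last first.
    apply/(sortedP 0%N) => t; rewrite size_rev size_tuple => lt_t.
    rewrite !nth_rev ?size_tuple //; last exact: ltnW.
    rewrite !nth_lam; try lia.
    by rewrite leq_add2r leq_mul2l; apply/orP; right; lia.
  rewrite -/lam head_lam; apply: tiling_sum_transfer; rewrite ?size_profile //.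
  move=> x; rewrite profileE => /mapP[t]; rewrite mem_iota => lt_t ->.
  have le_st : (s * t <= s * n)%N by rewrite leq_mul2l; apply/orP; right; lia.
  by rewrite mulSn; lia.
split; first by rewrite pathsE tilingsE.
rewrite pathsE (transfer_rows_det _ (size_profile _)); last first.
  by apply: sub_sorted sorted_b => x y; apply: ltnW.
transitivity (1 / 2%:R * \det (\matrix_(i < n.+1, j < n.+1)
    binomial_column l%:~R j (s.+1 * i + a)%N)).
  rewrite (@det_binomial_columns l%:~R n.+1 (fun i => s.+1 * i + a)%N) //.
  rewrite mulrA mul1r mulVf // mul1r; congr (\det _).
  apply/matrixP => i j; rewrite !mxE (nth_map 0%N) ?size_profile //.
  by rewrite profileE nth_mkseq // /w rmorphB.
congr (_ * \det _); apply/matrixP => i j; rewrite !mxE /binomial_column.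
by congr (_ * gbin _ _ + _); rewrite -natrD; congr _%:R; lia.
Qed.
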